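(* Let $\Phi_{KZ}$ be the Drinfel'd associator and $\gamma=p_{35}\circ p_{52}\circ p_{24}\circ p_{41}\circ p_{13}$. For any basis $B$ of $U\mathfrak B_5$, with dual basis $(b^* )_{b\in B}$ of $V(\mathcal M_{0,5})$, the relation $$\Phi_{KZ}(X_{12},X_{23})\Phi_{KZ}(X_{34},X_{45})\Phi_{KZ}(X_{51},X_{12})\Phi_{KZ}(X_{23},X_{34})\Phi_{KZ}(X_{45},X_{51})=1\quad\text{in }U\mathfrak B_5$$ is equivalent to $$\forall\, b\in B,\ b\ne1,\qquad\int_\gamma\mathrm{Reg}(b^*,\gamma)=0 .$$
   Context: **Drinfel'd associator.** $(\zeta^{sh}(W))_{W\in\{X_0,X_1\}^*}$ are the shuffle-regularized multiple zeta values: $\zeta^{sh}(X_0)=\zeta^{sh}(X_1)=0$; $\zeta^{sh}(X_0^{k_1-1}X_1\cdots X_0^{k_p-1}X_1)=\sum_{n_1>\cdots>n_p>0}n_1^{-k_1}\cdots n_p^{-k_p}$ if $k_1\ge2$; and $\zeta^{sh}(V)\zeta^{sh}(W)=\sum_U\zeta^{sh}(U)$ over all shuffles $U$ of $V,W$ (with multiplicity); $\zeta^{sh}(\emptyset)=1$. With $\mathrm{dp}(W)$ the number of letters $X_1$ in $W$, $\Phi_{KZ}(X_0,X_1)=\sum_W(-1)^{\mathrm{dp}(W)}\zeta^{sh}(W)W$, and $\Phi_{KZ}(A,B)$ denotes substitution. **$U\mathfrak B_5$ and bases.** $U\mathfrak B_5$ is the quotient of $\mathbb C\langle\langle X_{ij}\rangle\rangle$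 ($1\le i,j\le5$) by $X_{ii}=0$, $X_{ij}=X_{ji}$, $\sum_jX_{ij}=0$, and $[X_{ij},X_{kl}]=0$ if $\{i,j\}\cap\{k,l\}=\emptyset$; it is the completion of the graded algebra $\mathbb C\langle X_{ij}\rangle/\mathcal R$ with the same generators and relations. A basis $B$ of $U\mathfrak B_5$ is a vector space basis of $\mathbb C\langle X_{ij}\rangle/\mathcal R$ made of homogeneous elements such that every element of $U\mathfrak B_5$ is uniquely a series $\sum_{b\in B}a_bb$; its degree $0$ element is $1$. For a word $W\in\mathcal A=\{X_{34},X_{45},X_{24},X_{12},X_{23}\}^*$ write $W=\sum_{b\in B}l_{b,W}b$. **Geometry.** $\mathcal M_{0,5}=\{(x,y)\in(\mathbb P^1)^2: x,y\ne0,1,\infty,\ xy\neq1\}$ (the point $(x,y)$ being the class of $(z_1,\ldots,z_5)=(0,xy,y,1,\infty)$), with dihedral coordinates $u_{ij}=u_{ji}$: $u_{25}=x$, $u_{35}=y$, $u_{14}=1-xy$, $u_{13}=\frac{1-x}{1-xy}$, $u_{24}=\frac{1-y}{1-xy}$. The forms $d\log u_{ij}$ are a basis of $H^1_{dR}(\mathcal M_{0,5})$. Put $\omega_{12}=d\log u_{25}$, $\omega_{23}=d\log(u_{13}u_{14})$, $\omega_{34}=d\log(u_{24}u_{14})$, $\omega_{45}=d\log u_{35}$, $\omega_{24}=d\log u_{14}$. For $W=X_{i_nj_n}\cdots X_{i_1j_1}\in\mathcal A$, $\omega_W=[\omega_{i_nj_n}|\cdots|\omega_{i_1j_1}]\in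 H^1_{dR}(\mathcal M_{0,5})^{\otimes n}$. $V(\mathcal M_{0,5})=\oplus_mV_m$ is Brown's bar construction: $V_0=\mathbb C$, $V_1=H^1_{dR}$, and $V_m\subset (H^1_{dR})^{\otimes m}$ is the intersection of the kernels of the maps that wedge two adjacent factors into $H^2_{dR}$. It is the graded dual of $U\mathfrak B_5$, the basis dual to $B$ being $b^*=\sum_{W\in\mathcal A}l_{b,W}\,\omega_W$. **Boundary, paths, regularization.** In the partial compactification $\mathcal M_{0,5}^\delta$ (on which the $u_{ij}$ are regular functions), let $D_{ij}=D_{ji}$ be the divisor $u_{ij}=0$, and $P_3=D_{35}\cap D_{13}$, $P_1=D_{13}\cap D_{41}$, $P_4=D_{41}\cap D_{24}$, $P_2=D_{24}\cap D_{52}$, $P_5=D_{52}\cap D_{35}$. On $D_{ij}$ the two coordinates $u_{kl}$ whose chord crosses the chord $(i,j)$ of the pentagon are identically $1$; the remaining two restrict to functions $t,1-t$. For $j\equiv i-2\bmod5$, $p_{ji}$ is the real segment in $D_{ji}$ going from $P_i$ to $P_j$; choose the coordinate $t$ on $D_{ji}$ with $t=0$ at $P_i$, $t=1$ at $P_j$. $\mathrm{Reg}(\cdot,D_{ij})$ is the linear map sending $d\log u_{kl}$ to $0$ if $u_{kl}|_{D_{ij}}$ is identically $0$ or $1$, and to $d\log(u_{kl}|_{D_{ij}})$ otherwise, extended to tensors slotwise. The regularized iterated integral $\int_{p_{ji}}$ on words in $\frac{dt}{t},\frac{dt}{t-1}$ is the shuffle-regularized integral over $0<t_1<\cdots<t_n<1$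 of $[\nu_n|\cdots|\nu_1]\mapsto\nu_1(t_1)\wedge\cdots\wedge\nu_n(t_n)$: it equals this convergent integral if $\nu_n=\frac{dt}t$ and $\nu_1=\frac{dt}{t-1}$, vanishes on the single forms $\frac{dt}t,\frac{dt}{t-1}$, and is multiplicative for the shuffle product. Composition: $\beta\circ\alpha$ means first $\alpha$ then $\beta$, and for $\gamma=p_{35}\circ p_{52}\circ p_{24}\circ p_{41}\circ p_{13}$, $\int_\gamma\mathrm{Reg}(\omega_W,\gamma)=\sum_{U_1\cdots U_5=W}\int_{p_{35}}\mathrm{Reg}(\omega_{U_1},D_{35})\int_{p_{52}}\mathrm{Reg}(\omega_{U_2},D_{52})\int_{p_{24}}\mathrm{Reg}(\omega_{U_3},D_{24})\int_{p_{41}}\mathrm{Reg}(\omega_{U_4},D_{41})\int_{p_{13}}\mathrm{Reg}(\omega_{U_5},D_{13})$, extended linearly. *)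

(* Defs.v *)
From HB Require Import structures.
From mathcomp Require Import all_boot all_order all_algebra.
From mathcomp Require Import complex.
From mathcomp Require Import all_classical all_reals all_analysis.

Set Implicit Arguments.
Unset Strict Implicit.
Unset Printing Implicit Defensive.
Import Order.TTheory GRing.Theory Num.Theory.

Local Open Scope classical_set_scope.
Local Open Scope ring_scope.
Local Open Scope quotient_scope.
Local Open Scope complex_scope.

(* Noncommutative formal power series [K<<T>>].  The product is the Cauchy product for concatenation:
   [(f * g) w] is the sum of [f u * g v] over all factorizations [w = u ++ v]. *)

Definition ncseries (T : Type) (K : Type) : Type := seq T -> K.

HB.instance Definition _ (T : Type) (K : pzRingType) :=
  GRing.Zmodule.copy (ncseries T K) (seq T -> K).

Section NCSeries.
Variables (T : Type) (K : comPzRingType).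
Implicit Types (f g h : ncseries T K) (a b : K) (w : seq T).

Lemma ncfE f g w : (f + g) w = f w + g w. Proof. by []. Qed.

Definition ncscale a f : ncseries T K := fun w => a * f w.

Fact ncscaleA a b f : ncscale a (ncscale b f) = ncscale (a * b) f.
Proof. by apply/funext => w; rewrite /ncscale mulrA. Qed.

Fact ncscale1 f : ncscale 1 f = f.
Proof. by apply/funext => w; rewrite /ncscale mul1r. Qed.

Fact ncscaleDr a : {morph ncscale a : f g / f + g}.
Proof. by move=> f g; apply/funext => w; rewrite /ncscale mulrDr. Qed.

Fact ncscaleDl f : {morph ncscale^~ f : a b / a + b}.
Proof. by move=> a b; apply/funext => w; rewrite /ncscale mulrDl. Qed.

Fact ncscale0 f : ncscale 0 f = 0.
Proof. by apply/funext => w; rewrite /ncscale mul0r. Qed.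

HB.instance Definition _ := GRing.Zmodule_isLmodule.Build K (ncseries T K)
  ncscaleA ncscale1 ncscaleDr ncscaleDl.

Definition ncone : ncseries T K := fun w => (nilp w)%:R.

Definition ncmul f g : ncseries T K :=
  fun w => \sum_(k < (size w).+1) f (take k w) * g (drop k w).

Lemma ncmulE f g w :
  ncmul f g w = \sum_(k < (size w).+1) f (take k w) * g (drop k w).
Proof. by []. Qed.

Definition ncshift (x : T) f : ncseries T K := fun w => f (x :: w).

Lemma ncmul_nil f g : ncmul f g [::] = f [::] * g [::].
Proof. by rewrite /ncmul big_ord1. Qed.

Lemma ncmul_cons f g x w :
  ncmul f g (x :: w) = f [::] * g (x :: w) + ncmul (ncshift x f) g w.
Proof. by rewrite /ncmul big_ord_recl. Qed.

Fact ncmulDl : left_distributive ncmul +%R.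
Proof.
move=> f g h; apply/funext => w.
rewrite ncfE !ncmulE -big_split /=.
by apply: eq_bigr => k _; rewrite ncfE mulrDl.
Qed.

Fact ncmulDr : right_distributive ncmul +%R.
Proof.
move=> f g h; apply/funext => w.
rewrite ncfE !ncmulE -big_split /=.
by apply: eq_bigr => k _; rewrite ncfE mulrDr.
Qed.

Lemma ncscaleAl a f g : ncmul (ncscale a f) g = ncscale a (ncmul f g).
Proof.
apply/funext => w; rewrite /ncmul /ncscale big_distrr /=.
by apply: eq_bigr => k _; rewrite mulrA.
Qed.

Lemma ncscaleAr a f g : ncmul f (ncscale a g) = ncscale a (ncmul f g).
Proof.
apply/funext => w; rewrite /ncmul /ncscale big_distrr /=.
by apply: eq_bigr => k _; rewrite mulrCA.
Qed.

Lemma ncshiftM x f g :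
  ncshift x (ncmul f g) = ncscale (f [::]) (ncshift x g) + ncmul (ncshift x f) g.
Proof. by apply/funext => w; rewrite {1}/ncshift ncmul_cons. Qed.

Fact ncmulA : associative ncmul.
Proof.
move=> f g h; apply/funext => w; elim: w f g h => [|x w IH] f g h.
  by rewrite !ncmul_nil mulrA.
rewrite !ncmul_cons ncmul_nil ncshiftM ncmulDl ncscaleAl IH.
by rewrite ncfE /ncscale mulrDr mulrA addrA.
Qed.

Fact ncmul1l : left_id ncone ncmul.
Proof.
move=> f; apply/funext => -[|x w]; first by rewrite ncmul_nil mul1r.
rewrite ncmul_cons mul1r /ncmul big1 ?addr0 // => k _.
by rewrite /ncshift /ncone mul0r.
Qed.

Fact ncmul1r : right_id ncone ncmul.
Proof.
move=> f; apply/funext => w; elim: w f => [|x w IH] f.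
  by rewrite ncmul_nil mulr1.
by rewrite ncmul_cons IH mulr0 add0r.
Qed.

HB.instance Definition _ := GRing.Zmodule_isPzRing.Build (ncseries T K)
  ncmulA ncmul1l ncmul1r ncmulDl ncmulDr.

Lemma ncME f g w :
  (f * g) w = \sum_(k < (size w).+1) f (take k w) * g (drop k w).
Proof. by []. Qed.

Lemma ncmulZl a f g : (a *: f) * g = a *: (f * g).
Proof. exact: ncscaleAl. Qed.

Lemma ncmulZr a f g : f * (a *: g) = a *: (f * g).
Proof. exact: ncscaleAr. Qed.

Definition hpart (n : nat) f : ncseries T K :=
  fun w => if size w == n then f w else 0.

End NCSeries.

Definition ncword (K : comPzRingType) (T : eqType) (u : seq T) : ncseries T K :=
  fun w => (w == u)%:R.

(* [F(A false, A true)] for a series [F] in two letters.  The cut-off of the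
   length of [W] by the length of [w] loses nothing when [A false] and [A true]
   have no constant term, the only case in which substitution makes sense. *)
Definition ncsubst (T : Type) (K : comPzRingType) (F : ncseries bool K)
    (A : bool -> ncseries T K) : ncseries T K :=
  fun w => \sum_(n < (size w).+1) \sum_(W : n.-tuple bool)
             F W * (\prod_(x <- W) A x) w.

(* [ideal_gen rel] is the two-sided ideal of [K<T>] generated by [rel]; when all
   relators are homogeneous, a series is zero in the completion of
   [K<T> / ideal_gen rel] iff all its homogeneous components are in
   [ideal_gen rel]. *)

Section CompletedQuotient.
Variables (T : finType) (K : fieldType) (rel : ncseries T K -> Prop).
Implicit Types (f g h : ncseries T K).

Inductive ideal_gen : ncseries T K -> Prop :=
| ideal_gen0 : ideal_gen 0
| ideal_genD (a : K) (u v : seq T) (r f : ncseries T K) :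
    rel r -> ideal_gen f ->
    ideal_gen (a *: (ncword K u * r * ncword K v) + f).

Definition closed_ideal : {pred ncseries T K} :=
  fun f => `[< forall n, ideal_gen (hpart n f) >].

Lemma ideal_gen_add f g : ideal_gen f -> ideal_gen g -> ideal_gen (f + g).
Proof.
move=> If Ig; elim: If => [|a u v r h rr _ IH]; first by rewrite add0r.
by rewrite -addrA; apply: ideal_genD.
Qed.

Lemma ideal_gen_scale a f : ideal_gen f -> ideal_gen (a *: f).
Proof.
elim=> [|b u v r h rr _ IH]; first by rewrite scaler0; exact: ideal_gen0.
by rewrite scalerDr scalerA; apply: ideal_genD.
Qed.

Lemma ideal_gen_sum (I : Type) (s : seq I) (P : pred I) (F : I -> ncseries T K) :
  (forall i, P i -> ideal_gen (F i)) -> ideal_gen (\sum_(i <- s | P i) F i).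
Proof.
move=> H; apply: (big_ind ideal_gen) => //; first exact: ideal_gen0.
exact: ideal_gen_add.
Qed.

Lemma ncsumE (I : Type) (s : seq I) (P : pred I) (F : I -> ncseries T K) w :
  (\sum_(i <- s | P i) F i) w = \sum_(i <- s | P i) F i w.
Proof. by elim/big_rec2: _ => // i y1 y2 _ <-. Qed.

Lemma ncword0 : ncword K ([::] : seq T) = 1.
Proof. by apply/funext => w; rewrite /ncword; case: w. Qed.

Lemma ncwordM (u v : seq T) : ncword K u * ncword K v = ncword K (u ++ v).
Proof.
elim: u => [|y u IH]; first by rewrite ncword0 mul1r.
apply/funext => -[|x w]; first by rewrite [LHS]ncmul_nil mul0r.
rewrite [LHS]ncmul_cons mul0r add0r /ncword /= eqseq_cons.
have -> : ncshift x (fun w => (w == y :: u)%:R) = ncscale (x == y)%:R (ncword K u).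
  by apply/funext => z; rewrite /ncshift /ncscale /ncword eqseq_cons -mulnb natrM.
rewrite ncscaleAl /ncscale -mulnb natrM; congr (_ * _).
exact: (congr1 (fun f => f w) IH).
Qed.

Lemma ideal_genMl u f : ideal_gen f -> ideal_gen (ncword K u * f).
Proof.
elim=> [|a u' v r h rr _ IH]; first by rewrite mulr0; exact: ideal_gen0.
rewrite mulrDr ncmulZr !mulrA ncwordM.
exact: ideal_genD.
Qed.

Lemma ideal_genMr u f : ideal_gen f -> ideal_gen (f * ncword K u).
Proof.
elim=> [|a u' v r h rr _ IH]; first by rewrite mul0r; exact: ideal_gen0.
rewrite mulrDl ncmulZl -!mulrA ncwordM !mulrA.
exact: ideal_genD.
Qed.

Lemma hpart_words n f : hpart n f = \sum_(u : n.-tuple T) f u *: ncword K u.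
Proof.
apply/funext => w; rewrite ncsumE /hpart; case: eqP => [sw|sw]; last first.
  rewrite big1 // => u _; rewrite [LHS]/(f u * _) /ncword.
  case: eqP => [wu|_]; last exact: mulr0.
  by case: sw; rewrite wu size_tuple.
have /eqP sw' := sw; rewrite (bigD1 (Tuple sw')) //= big1 ?addr0.
  by rewrite [RHS]/(f w * _) /ncword eqxx; apply/esym/mulr1.
move=> u uw; rewrite [LHS]/(f u * _) /ncword.
case: eqP => [wu|_]; last exact: mulr0.
by case/eqP: uw; apply/val_inj.
Qed.

Lemma hpartM n f g :
  hpart n (f * g) = \sum_(k < n.+1) hpart k f * hpart (n - k)%N g.
Proof.
apply/funext => w; rewrite ncsumE /hpart.
under eq_bigr => k _ do rewrite ncME.
case: eqP => [sw|/eqP sw]; last first.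
  rewrite big1 // => k _; rewrite big1 // => j _.
  rewrite size_drop size_take_min; case: eqP => [jk|]; rewrite ?mul0r //.
  case: eqP => [jk'|]; rewrite ?mulr0 //; case/eqP: sw.
  have := ltn_ord j; have := ltn_ord k; rewrite !ltnS => kn jw.
  by rewrite -(subnKC jw) jk' -jk (minn_idPl jw) subnKC // -(minn_idPl jw) jk.
rewrite -sw ncME; apply: eq_bigr => k _.
have kw : (k <= size w)%N by rewrite -ltnS.
rewrite (bigD1 k) //= size_drop size_take_min (minn_idPl kw) !eqxx big1 ?addr0 // => j jk.
rewrite size_take_min (minn_idPl _) -1?ltnS //.
by rewrite -(inj_eq val_inj) /= in jk; rewrite (negPf jk) mul0r.
Qed.

Lemma hpartB n f g : hpart n (f - g) = hpart n f - hpart n g.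
Proof.
apply/funext => w; rewrite ncfE [(- hpart n g) w]/(- (hpart n g w)) /hpart.
by case: (size w == n); [|apply/esym; rewrite -[RHS](subrr 0)].
Qed.

Lemma hpartZ n a f : hpart n (a *: f) = a *: hpart n f.
Proof.
apply/funext => w; rewrite [RHS]/(a * hpart n f w) /hpart.
by case: (size w == n); [|apply/esym/mulr0].
Qed.

Lemma hpartK m n f : hpart m (hpart n f) = if m == n then hpart n f else 0.
Proof.
apply/funext => w; case: (eqVneq m n) => [->|mn]; rewrite /hpart.
  by case: (size w == n).
by case: eqP => // ->; rewrite (negPf mn).
Qed.

Fact closed_ideal_zmod : zmod_closed closed_ideal.
Proof.
split.
  apply/asboolP => n; suff -> : hpart n (0 : ncseries T K) = 0 by exact: ideal_gen0.
  by apply/funext => w; rewrite /hpart; case: (size w == n).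
move=> f g /asboolP If /asboolP Ig; apply/asboolP => n.
by rewrite hpartB -scaleN1r; apply: ideal_gen_add => //; apply: ideal_gen_scale.
Qed.

HB.instance Definition _ :=
  GRing.isZmodClosed.Build (ncseries T K) closed_ideal closed_ideal_zmod.

Lemma closed_idealZ a f : f \in closed_ideal -> a *: f \in closed_ideal.
Proof.
by move=> /asboolP If; apply/asboolP => n; rewrite hpartZ; apply: ideal_gen_scale.
Qed.

Lemma closed_idealMl g f : f \in closed_ideal -> g * f \in closed_ideal.
Proof.
move=> /asboolP If; apply/asboolP => n; rewrite hpartM; apply: ideal_gen_sum => k _.
rewrite hpart_words mulr_suml; apply: ideal_gen_sum => u _.
by rewrite ncmulZl; apply: ideal_gen_scale; apply: ideal_genMl.
Qed.

Lemma closed_idealMr g f : f \in closed_ideal -> f * g \in closed_ideal.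
Proof.
move=> /asboolP If; apply/asboolP => n; rewrite hpartM; apply: ideal_gen_sum => k _.
rewrite [hpart (n - k) g]hpart_words mulr_sumr; apply: ideal_gen_sum => u _.
by rewrite ncmulZr; apply: ideal_gen_scale; apply: ideal_genMr.
Qed.

Definition completed_quotient : Type := Quotient.quot closed_ideal.

HB.instance Definition _ := GRing.Zmodule.on completed_quotient.
HB.instance Definition _ := Choice.on completed_quotient.
Local Notation U := completed_quotient.

Definition ncproj (f : ncseries T K) : U := \pi_(Quotient.quot closed_ideal) f.

Lemma ncproj_eq f g : ncproj f = ncproj g <-> f - g \in closed_ideal.
Proof. by rewrite Quotient.idealrBE; split => /eqP. Qed.

Lemma ncproj_repr (x : U) : exists f, x = ncproj f.
Proof. by exists (repr (x : Quotient.quot closed_ideal)); rewrite /ncproj reprK. Qed.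

Lemma ncprojK (f : ncseries T K) :
  repr (ncproj f : Quotient.quot closed_ideal) - f \in closed_ideal.
Proof. by apply/ncproj_eq; rewrite /ncproj reprK. Qed.

Lemma ncprojD : {morph ncproj : f g / f + g}.
Proof. by move=> f g; rewrite /ncproj raddfD. Qed.

Definition qscale (a : K) (x : U) : U := ncproj (a *: repr (x : Quotient.quot closed_ideal)).

Lemma ncprojZ a f : ncproj (a *: f) = qscale a (ncproj f).
Proof.
apply/esym/ncproj_eq; rewrite -scalerBr; apply: closed_idealZ; exact: ncprojK.
Qed.

Fact qscaleA a b x : qscale a (qscale b x) = qscale (a * b) x.
Proof. by have [f ->] := ncproj_repr x; rewrite -!ncprojZ scalerA. Qed.

Fact qscale1 x : qscale 1 x = x.
Proof. by have [f ->] := ncproj_repr x; rewrite -!ncprojZ scale1r. Qed.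

Fact qscaleDr : right_distributive qscale +%R.
Proof.
move=> a x y; have [f ->] := ncproj_repr x; have [g ->] := ncproj_repr y.
by rewrite -ncprojD -!ncprojZ scalerDr ncprojD.
Qed.

Fact qscaleDl x : {morph qscale^~ x : a b / a + b}.
Proof.
move=> a b; have [f ->] := ncproj_repr x.
by rewrite -!ncprojZ scalerDl ncprojD.
Qed.

HB.instance Definition _ := GRing.Zmodule_isLmodule.Build K U
  qscaleA qscale1 qscaleDr qscaleDl.

Definition qmul (x y : U) : U :=
  ncproj (repr (x : Quotient.quot closed_ideal) * repr (y : Quotient.quot closed_ideal)).

Lemma ncprojM_subproof f g : ncproj (f * g) = qmul (ncproj f) (ncproj g).
Proof.
apply/esym/ncproj_eq; set f' := repr _; set g' := repr _.
have -> : f' * g' - f * g = (f' - f) * g' + f * (g' - g).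
  by rewrite mulrBl mulrBr addrA subrK.
by apply: rpredD; [apply: closed_idealMr | apply: closed_idealMl]; exact: ncprojK.
Qed.

Fact qmulA : associative qmul.
Proof.
move=> x y z; have [f ->] := ncproj_repr x; have [g ->] := ncproj_repr y.
by have [h ->] := ncproj_repr z; rewrite -!ncprojM_subproof mulrA.
Qed.

Fact qmul1l : left_id (ncproj 1) qmul.
Proof. by move=> x; have [f ->] := ncproj_repr x; rewrite -ncprojM_subproof mul1r. Qed.

Fact qmul1r : right_id (ncproj 1) qmul.
Proof. by move=> x; have [f ->] := ncproj_repr x; rewrite -ncprojM_subproof mulr1. Qed.

Fact qmulDl : left_distributive qmul +%R.
Proof.
move=> x y z; have [f ->] := ncproj_repr x; have [g ->] := ncproj_repr y.
have [h ->] := ncproj_repr z.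
by rewrite -ncprojD -!ncprojM_subproof mulrDl ncprojD.
Qed.

Fact qmulDr : right_distributive qmul +%R.
Proof.
move=> x y z; have [f ->] := ncproj_repr x; have [g ->] := ncproj_repr y.
have [h ->] := ncproj_repr z.
by rewrite -ncprojD -!ncprojM_subproof mulrDr ncprojD.
Qed.

HB.instance Definition _ := GRing.Zmodule_isPzRing.Build U
  qmulA qmul1l qmul1r qmulDl qmulDr.

Lemma ncprojM : {morph ncproj : f g / f * g}.
Proof. exact: ncprojM_subproof. Qed.

(* Independent of the representative, by [qhpartE]. *)
Definition qhpart (n : nat) (x : U) : U :=
  ncproj (hpart n (repr (x : Quotient.quot closed_ideal))).

Lemma qhpartE n f : qhpart n (ncproj f) = ncproj (hpart n f).
Proof.
apply/ncproj_eq; rewrite -hpartB; apply/asboolP => m; rewrite hpartK.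
by case: ifP => [_|_]; [move/asboolP: (ncprojK f); exact | exact: ideal_gen0].
Qed.

Definition qhomog (n : nat) : set U := [set x | qhpart n x = x].

(* The image of the polynomials, a copy of [K<T> / ideal_gen rel]. *)
Definition qpoly : set U :=
  [set x | exists2 f : ncseries T K, finite_set [set w | f w != 0] & x = ncproj f].

(* [x] is the finite linear combination of the elements of [B] with
   coefficients [a]. *)
Definition is_lincomb (B : set U) (a : U -> K) (x : U) : Prop :=
  finite_set [set b | B b /\ a b != 0] /\ x = \sum_(b \in B) a b *: b.

(* [x] is the series of the [a b *: b], [b] in [B], where [B] is made of
   homogeneous elements, with finitely many of them in each degree. *)
Definition is_series (B : set U) (a : U -> K) (x : U) : Prop :=
  forall n, qhpart n x = \sum_(b \in B `&` qhomog n) a b *: b.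

Record is_basis (B : set U) : Prop := IsBasis {
  basis_homog : forall b, B b -> qpoly b /\ exists n, qhomog n b;
  basis_poly : forall x, qpoly x -> exists a, is_lincomb B a x;
  basis_poly_unique : forall x a a', is_lincomb B a x -> is_lincomb B a' x ->
    forall b, B b -> a b = a' b;
  basis_series : forall x, exists a, is_series B a x;
  basis_series_unique : forall x a a', is_series B a x -> is_series B a' x ->
    forall b, B b -> a b = a' b;
  basis_deg0 : B `&` qhomog 0 = [set 1] }.

(* The coefficients of [x] on the basis [B] (meaningful for [x] in [qpoly] and
   at elements of [B]). *)
Definition coord (B : set U) (x : U) : U -> K :=
  xget (fun=> 0) [set a | is_lincomb B a x].

End CompletedQuotient.

(* All the shuffles of two words, listed with multiplicity. *)
Fixpoint shuffle (T : Type) (u : seq T) : seq T -> seq (seq T) :=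
  if u is x :: u' then
    fix shuffle_u (v : seq T) : seq (seq T) :=
      if v is y :: v' then
        [seq x :: w | w <- shuffle u' v] ++ [seq y :: w | w <- shuffle_u v']
      else [:: u]
  else fun v => [:: v].

(* [X_0^{k_1 - 1} X_1 ... X_0^{k_p - 1} X_1], with [false] for [X_0] and [true]
   for [X_1]. *)
Definition mzv_word (ks : seq nat) : seq bool :=
  flatten [seq rcons (nseq k.-1 false) true | k <- ks].

Definition mzv (R : realType) (ks : seq nat) : \bar R :=
  \esum_(s in [set s : seq nat |
                [&& size s == size ks, sorted gtn s & all (leq 1) s]])
    (\prod_(p <- zip s ks) p.1%:R ^- p.2)%:E.

Record is_zeta_sh (R : realType) (zeta : seq bool -> R) : Prop := IsZetaSh {
  zeta_sh_nil : zeta [::] = 1;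
  zeta_sh_X0 : zeta [:: false] = 0;
  zeta_sh_X1 : zeta [:: true] = 0;
  zeta_sh_mzv : forall (k : nat) (ks : seq nat), (2 <= k)%N -> all (leq 1) ks ->
    (zeta (mzv_word (k :: ks)))%:E = mzv R (k :: ks);
  zeta_sh_shuffle : forall v w : seq bool,
    zeta v * zeta w = \sum_(u <- shuffle v w) zeta u }.

Definition PhiKZ (R : realType) (zeta : seq bool -> R) : ncseries bool R[i] :=
  fun W => (-1) ^+ count_mem true W * (zeta W)%:C.

(* A word in [dt/t] ([false]) and [dt/(t-1)] ([true]) is read as a tensor
   [[nu_n | ... | nu_1]]: the head of the list is the form in the largest
   variable [t_n]. *)

Definition form01 (R : realType) (a : bool) (t : R) : R :=
  if a then (t - 1)^-1 else t^-1.

(* The integral over [0 < t_1 < ... < t_n < t], the outermost integration being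
   with respect to [t_n]. *)
Fixpoint iter_int (R : realType) (w : seq bool) (t : R) : R :=
  if w is a :: w' then
    \int[@lebesgue_measure R]_(s in `]0, t[) (form01 a s * iter_int w' s)
  else 1.

Record is_reg_int (R : realType) (J : seq bool -> R) : Prop := IsRegInt {
  reg_int_nil : J [::] = 1;
  reg_int_single : forall a : bool, J [:: a] = 0;
  reg_int_conv : forall w : seq bool,
    J (false :: rcons w true) = iter_int (false :: rcons w true) 1;
  reg_int_shuffle : forall v w : seq bool,
    J v * J w = \sum_(u <- shuffle v w) J u }.

(* The indices 1, ..., 5 are the elements of ['I_5], viewed as the ring Z/5; in
   particular 5 = 0. *)

Definition gen5 : finType := ('I_5 * 'I_5)%type.

Section B5.
Variable K : fieldType.

Definition X5 (i j : 'I_5) : ncseries gen5 K := ncword K [:: (i, j)].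

Inductive rel5 : ncseries gen5 K -> Prop :=
| rel5_diag i : rel5 (X5 i i)
| rel5_sym i j : rel5 (X5 i j - X5 j i)
| rel5_sum i : rel5 (\sum_j X5 i j)
| rel5_comm i j k l : [&& i != k, i != l, j != k & j != l] ->
    rel5 (X5 i j * X5 k l - X5 k l * X5 i j).

Definition UB5 := completed_quotient rel5.

End B5.

(* [PhiKZ(X_ij, X_kl)] in [UB_5] *)
Definition PhiKZ_UB5 (R : realType) (zeta : seq bool -> R) (i j k l : 'I_5) :
    UB5 R[i] :=
  ncproj (@rel5 R[i])
    (ncsubst (PhiKZ zeta) (fun a => if a then X5 R[i] k l else X5 R[i] i j)).

(* The five chords [{i, i+2}] of the pentagon, which index the dihedral
   coordinates. *)
Definition chord : finType := {c : 'I_5 * 'I_5 | c.2 == c.1 + 2}.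

Definition on_chord (i : 'I_5) (c : chord) : bool :=
  (i == (val c).1) || (i == (val c).2).

Section Bar.
Variable R : realType.
Local Notation C := R[i].

(* [H^1_dR(M_{0,5})], by coordinates on its basis [(dlog u_c)_c]. *)
Definition H1 := {ffun chord -> C}.

Definition dlogc (c : chord) : H1 := [ffun d => (d == c)%:R].

Definition dlogu (i j : 'I_5) : H1 :=
  [ffun c => ((val c == (i, j)) || (val c == (j, i)))%:R].

(* The five letters of the alphabet of [A], which are the only generators at
   which [omega] below is meaningful. *)
Definition lettersA : seq gen5 := [:: (3, 4); (4, 5); (2, 4); (1, 2); (2, 3)].

Definition omega (g : gen5) : H1 :=
  if g == (1, 2) then dlogu 2 5
  else if g == (2, 3) then dlogu 1 3 + dlogu 1 4
  else if g == (3, 4) then dlogu 2 4 + dlogu 1 4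
  else if g == (4, 5) then dlogu 3 5
  else if g == (2, 4) then dlogu 1 4
  else 0.

(* The pure tensor [[eta_n | ... | eta_1]], for the list [s] of the [eta]'s in
   this order.  A tensor in [T(H^1)] is given by its coordinates on the words in
   the [dlog u_c]; all the tensors below have finite support. *)
Definition bar (s : seq H1) : ncseries chord C :=
  fun c => if size c == size s then \prod_(p <- zip s c) p.1 p.2 else 0.

Variant restriction := RestrZero | RestrOne | RestrT | Restr1T.

(* The restriction of [u_c] to [D_ji], with [t = 0] at [P_i] and [t = 1] at
   [P_j].  A chord crosses [{i, j}] iff it contains neither [i] nor [j], and
   [P_k] is the intersection of the divisors of the two chords through [k]: the
   coordinate of the other chord through [i] vanishes at [P_i] and restricts to
   [t], that of the other chord through [j] vanishes at [P_j] and restricts to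
   [1 - t]. *)
Definition restr (j i : 'I_5) (c : chord) : restriction :=
  match on_chord i c, on_chord j c with
  | true, true => RestrZero
  | false, false => RestrOne
  | true, false => RestrT
  | false, true => Restr1T
  end.

(* Combinations of [dt/t] ([false]) and [dt/(t-1)] ([true]). *)
Definition dlog_restr (r : restriction) : {ffun bool -> C} :=
  match r with
  | RestrZero | RestrOne => 0
  | RestrT => [ffun a => (a == false)%:R]
  | Restr1T => [ffun a => (a == true)%:R]
  end.

Definition Reg (j i : 'I_5) (eta : H1) : {ffun bool -> C} :=
  \sum_(c : chord) eta c *: dlog_restr (restr j i c).

Variable J : seq bool -> R.

(* The regularized integral along [p_ji] of
   [[Reg(eta_n, D_ji) | ... | Reg(eta_1, D_ji)]]. *)
Definition path_int (j i : 'I_5) : ncseries H1 C :=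
  fun s => \sum_(v : (size s).-tuple bool)
             (\prod_(p <- zip s v) Reg j i p.1 p.2) * (J v)%:C.

(* The integral of [Reg(s, gamma)] for a pure tensor [s]: by definition of the
   product of series, this is the sum over all deconcatenations of [s] into five
   factors of the products of the integrals along the five segments. *)
Definition gamma_int_pure : ncseries H1 C :=
  path_int 3 5 * path_int 5 2 * path_int 2 4 * path_int 4 1 * path_int 1 3.

(* Its linear extension to tensors (see [gamma_int_bar]). *)
Definition gamma_int (tau : ncseries chord C) : C :=
  \sum_(c \in [set: seq chord]) tau c * gamma_int_pure (map dlogc c).

(* The element [b^*] of the basis dual to [B]: the sum of the
   [l_{b,W} omega_W]. *)
Definition dual_elt (B : set (UB5 C)) (b : UB5 C) : ncseries chord C :=
  \sum_(W \in [set W : seq gen5 | all (mem lettersA) W])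
    coord B (ncproj (@rel5 C) (ncword C W)) b *: bar (map omega W).


Definition slot_linear (F : ncseries H1 C) : Prop :=
  forall s1 eta s2, F (s1 ++ eta :: s2) =
    \sum_(c : chord) eta c * F (s1 ++ dlogc c :: s2).

Lemma slot_linearM F G : slot_linear F -> slot_linear G -> slot_linear (F * G).
Proof.
move=> FL GL s1 eta s2; under eq_bigr do rewrite ncME big_distrr /=.
rewrite ncME; set n := size (s1 ++ eta :: s2).
have nE c : size (s1 ++ dlogc c :: s2) = n by rewrite /n !size_cat.
under eq_bigr do rewrite nE.
rewrite exchange_big /=; apply: eq_bigr => k _.
rewrite !take_cat !drop_cat; case: ifP => ks1.
  rewrite GL mulr_sumr; apply: eq_bigr => c _.
  by rewrite take_cat drop_cat ks1 mulrCA.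
case ek : (k - size s1)%N => [|m] /=.
  rewrite cats0 (GL [::]) mulr_sumr; apply: eq_bigr => c _.
  by rewrite take_cat drop_cat ks1 ek /= cats0 mulrCA.
rewrite FL mulr_suml; apply: eq_bigr => c _.
by rewrite take_cat drop_cat ks1 ek /= mulrA.
Qed.

Lemma path_intE j i n s : size s = n ->
  path_int j i s = \sum_(v : n.-tuple bool)
    (\prod_(p <- zip s v) Reg j i p.1 p.2) * (J v)%:C.
Proof. by move=> <-. Qed.

Lemma Reg_dlogc j i c : Reg j i (dlogc c) = dlog_restr (restr j i c).
Proof.
rewrite /Reg (bigD1 c) //= ffunE eqxx scale1r big1 ?addr0 // => d dc.
by rewrite ffunE (negPf dc) scale0r.
Qed.

Lemma path_int_slot_linear j i : slot_linear (path_int j i).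
Proof.
move=> s1 eta s2; pose n := size (s1 ++ eta :: s2).
have nE c : size (s1 ++ dlogc c :: s2) = n by rewrite /n !size_cat.
rewrite (path_intE _ _ (erefl n)).
under [RHS]eq_bigr => c _ do rewrite (path_intE _ _ (nE c)) big_distrr /=.
rewrite exchange_big /=; apply: eq_bigr => v _.
have s1v : (size s1 < size v)%N by rewrite size_tuple /n size_cat /= addnS ltnS leq_addr.
rewrite -[tval v](cat_take_drop (size s1)) (drop_nth true) //.
set v1 := take _ _; set v2 := drop _.+1 _; set a := nth _ _ _.
have v1s : size s1 = size v1 by rewrite size_take s1v.
under [RHS]eq_bigr do rewrite zip_cat // big_cat big_cons /= Reg_dlogc.
rewrite zip_cat // big_cat big_cons /= /Reg sum_ffunE !mulr_suml mulr_sumr mulr_suml.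
apply: eq_bigr => c _; rewrite ffunE; set x := dlog_restr _ a.
by rewrite -[eta c *: x]/(eta c * x) !mulrA [_ * eta c]mulrC.
Qed.

Lemma gamma_int_pure_slot_linear : slot_linear gamma_int_pure.
Proof. by do !apply: slot_linearM => //; apply: path_int_slot_linear. Qed.

Lemma bar_cons eta s c w : bar (eta :: s) (c :: w) = eta c * bar s w.
Proof.
by rewrite /bar /= eqSS big_cons /=; case: ifP => // _; rewrite mulr0.
Qed.

Lemma slot_linear_bar F : slot_linear F -> forall s : seq H1,
  F s = \sum_(c \in [set: seq chord]) bar s c * F (map dlogc c).
Proof.
move=> FL s.
pose fix words n : seq (seq chord) :=
  if n is m.+1 then [seq c :: w | c <- enum chord, w <- words m] else [:: [::]].
have words_uniq n : uniq (words n).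
  elim: n => //= n IH; apply: allpairs_uniq => //; first exact: enum_uniq.
  by move=> [c w] [c' w'] _ _ /= [-> ->].
have mem_words c : c \in words (size c).
  elim: c => //= x c IH; apply/allpairsP; exists (x, c).
  by rewrite mem_enum.
rewrite (fsbigE (words (size s))) //; last first.
  move=> c _; rewrite /bar; case: eqP => [<-|_ _]; last by rewrite mul0r.
  by rewrite mem_words.
under eq_bigl do rewrite in_setT.
suff H pre : F (pre ++ s) =
    \sum_(c <- words (size s)) bar s c * F (pre ++ map dlogc c) by exact: (H [::]).
elim: s pre => [|eta s IH] pre /=.
  by rewrite big_seq1 /bar /= big_nil mul1r.
rewrite FL big_allpairs_dep big_enum /=; apply: eq_bigr => c _.
rewrite -cat_rcons IH big_distrr /=; apply: eq_bigr => w _.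
by rewrite bar_cons mulrA cat_rcons.
Qed.

Lemma gamma_int_bar (s : seq H1) : gamma_int (bar s) = gamma_int_pure s.
Proof. exact/esym/slot_linear_bar/gamma_int_pure_slot_linear. Qed.

End Bar.

(* Main.v *)
Require Import Defs.
From mathcomp Require Import all_boot all_order all_algebra.
From mathcomp Require Import complex.
From mathcomp Require Import all_classical all_reals all_analysis.
From mathcomp Require Import measurable_realfun ring.

Set Implicit Arguments.
Unset Strict Implicit.
Unset Printing Implicit Defensive.
Import Order.TTheory GRing.Theory Num.Theory.
Import numFieldNormedType.Exports.
Local Open Scope classical_set_scope.
Local Open Scope ring_scope.
Local Open Scope complex_scope.

(** The product of the five associators is the class in U B_5 of one explicit
    series, and the integrals along gamma are the coefficients of that class on
    the basis B; the equivalence is then the uniqueness of coefficients.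

    Summing omega_W W over the words W in the five letters gives the
    noncommutative generating series of iterated integrals of the one-form
    sum_g omega_g X_g.  On a divisor D_ji this form restricts to
    A dt/t + B dt/(t-1), where A and B are linear combinations of the X_g: for
    instance X_12 and X_23 on D_35, and X_23 + X_34 + X_24 and X_12 on D_24.
    So the generating series of the regularized integrals along p_ji is the
    series sum_V J(V) V evaluated at (A, B) ([path_int_omega]).  In U B_5 one has
    X_23 + X_34 + X_24 = X_51 ([UB5_51]), hence the five pairs (A, B) are, in the
    order of gamma, those of the pentagon relation ([ncproj_path_letters]).
    Deconcatenation of words is dual to the product of series, so the series
    with coefficients the integrals of Reg(omega_W, gamma) has as its class the
    product of the five associators ([ncproj_gamma_int]).

    This needs J(V) = (-1)^dp(V) zeta(V) ([reg_int_zeta]).  Both sides are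
    characters of the shuffle algebra that vanish on the two letters, and such a
    character is determined by its values on the convergent words
    ([shuffle_character_eq]).  On those, the iterated integral is computed by
    integrating power series term by term ([iter_intE]), and the value at 1 of
    the resulting power series is the nested sum ([mzv_series]).

    Finally, expanding each word on B shows that b has coefficient
    sum_W l_{b,W} int_gamma Reg(omega_W, gamma) = int_gamma Reg(b^*, gamma)
    in the class ([gamma_int_series]); at b = 1 this is 1, so the class is 1 iff
    all the other coefficients vanish ([series_eq_one]). *)

(** * Uniqueness of shuffle regularization *)

Definition shuffle_character (R : pzRingType) (f : seq bool -> R) : Prop :=
  forall v w, f v * f w = \sum_(u <- shuffle v w) f u.

Lemma sum_shuffle1 (M : zmodType) (T : Type) (x y : T) (w : seq T)
    (f : seq T -> M) :
  \sum_(u <- shuffle [:: x] (y :: w)) f u =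
  f (x :: y :: w) + \sum_(u <- shuffle [:: x] w) f (y :: u).
Proof. by rewrite /= big_cons big_map; case: w. Qed.

Lemma sum_shuffle1_rcons (M : zmodType) (T : Type) (x y : T) (w : seq T)
    (f : seq T -> M) :
  \sum_(u <- shuffle [:: x] (rcons w y)) f u =
  f (rcons (rcons w y) x) + \sum_(u <- shuffle [:: x] w) f (rcons u y).
Proof.
elim: w f => [|z w IH] f; first by rewrite sum_shuffle1 !big_seq1 addrC.
rewrite [rcons (z :: w) y]/= sum_shuffle1 (IH (fun u => f (z :: u))).
by rewrite sum_shuffle1 addrCA.
Qed.

(** Shuffling a letter into a block of n copies of itself produces the same word
    n times; this multiplicity is what lets the shuffle relations be solved for
    a word with one more letter in the block. *)
Lemma sum_shuffle1_nseq (M : zmodType) (T : Type) (x : T) n (w : seq T)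
    (f : seq T -> M) :
  \sum_(u <- shuffle [:: x] (nseq n x ++ w)) f u =
  f (nseq n.+1 x ++ w) *+ n + \sum_(u <- shuffle [:: x] w) f (nseq n x ++ u).
Proof.
elim: n f => [|n IH] f; first by rewrite mulr0n add0r.
rewrite [nseq n.+1 x ++ w]/= sum_shuffle1 (IH (fun u => f (x :: u))).
by rewrite addrA mulrS.
Qed.

Lemma cat_nseq_cons (T : Type) (x : T) n (w : seq T) :
  nseq n x ++ x :: w = nseq n.+1 x ++ w.
Proof. by elim: n => //= n ->. Qed.

Lemma sum_shuffle1_cat_nseq (M : zmodType) (T : Type) (x : T) n (w : seq T)
    (f : seq T -> M) :
  \sum_(u <- shuffle [:: x] (w ++ nseq n x)) f u =
  f (w ++ nseq n.+1 x) *+ n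
  + \sum_(u <- shuffle [:: x] w) f (u ++ nseq n x).
Proof.
elim: w f => [|y w IH] f.
  have := sum_shuffle1_nseq x n [::] f; rewrite !cats0 => ->.
  by rewrite !big_seq1 cat_nseq_cons cats0.
rewrite [(y :: w) ++ _]/= sum_shuffle1 (IH (fun u => f (y :: u))).
by rewrite sum_shuffle1 /= addrCA.
Qed.

Lemma nseq_cat_split (x : bool) (w : seq bool) :
  exists n w', w = nseq n x ++ w' /\ (w' = [::] \/ exists w'', w' = ~~ x :: w'').
Proof.
elim: w => [|y w [n [w' [-> H]]]]; first by exists 0%N, [::]; split => //; left.
have [->|xy] := eqVneq y x; first by exists n.+1, w'.
exists 0%N, (y :: nseq n x ++ w'); split => //; right.
by exists (nseq n x ++ w'); move: xy; case: x {H}; case: y.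
Qed.

Lemma cat_nseq_split (x : bool) (w : seq bool) :
  exists n w', w = w' ++ nseq n x /\
    (w' = [::] \/ exists w'', w' = rcons w'' (~~ x)).
Proof.
have [n [w' [e H]]] := nseq_cat_split x (rev w).
exists n, (rev w'); split; first by rewrite -(revK w) e rev_cat rev_nseq.
case: H => [->|[w'' ->]]; [by left | right].
by exists (rev w''); rewrite rev_cons.
Qed.

(** Uniqueness of the shuffle regularization.  For a word with n + 1 leading
    letters [true], the product of [true] with the word with n of them expresses
    n + 1 times its value by values at words with n leading letters [true];
    trailing letters [false] are removed in the same way, until the word is
    convergent.  The difference h of the two characters is not multiplicative,
    but the shuffle product of h with a single letter is still zero. *)
Lemma shuffle_character_eq (R : numDomainType) (f g : seq bool -> R) :
  shuffle_character f -> shuffle_character g ->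
  f [::] = 1 -> g [::] = 1 ->
  (forall a, f [:: a] = 0) -> (forall a, g [:: a] = 0) ->
  (forall w, f (false :: rcons w true) = g (false :: rcons w true)) ->
  f =1 g.
Proof.
move=> fM gM f0 g0 f1 g1 fg.
pose h w := f w - g w.
suff h0 w : h w = 0 by move=> w; apply/eqP; rewrite -subr_eq0; apply/eqP/h0.
have shuffle_h a v : \sum_(u <- shuffle [:: a] v) h u = 0.
  by rewrite sumrB -fM -gM f1 g1 !mul0r subrr.
have h_cancel n (x y : R) : x *+ n + (x + y) = 0 -> y = 0 -> x = 0.
  move=> + y0; rewrite y0 addr0 -mulrSr => /eqP.
  by rewrite mulrn_eq0 => /eqP.
have h_nseq a n : h (nseq n a) = 0.
  case: n => [|n]; first by rewrite /h f0 g0 subrr.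
  apply: (h_cancel n _ 0) => //; rewrite addr0.
  have := sum_shuffle1_nseq a n [::] h.
  by rewrite big_seq1 cat_nseq_cons !cats0 shuffle_h.
have h_false_true m v : h (false :: rcons v true ++ nseq m false) = 0.
  elim: m v => [|m IH] v; first by rewrite cats0 /h fg subrr.
  have := sum_shuffle1_cat_nseq false m (false :: rcons v true) h.
  rewrite shuffle_h -rcons_cons sum_shuffle1_rcons (cat_rcons false) => /esym H.
  apply: (h_cancel _ _ _ H) => {H}.
  rewrite sum_shuffle1 (IH (false :: v)) add0r.
  by rewrite big1_seq // => u _; exact: IH.
have h_false v : h (false :: v) = 0.
  have [n [w' [-> [->|[w'' ->]]]]] := cat_nseq_split false v.
    exact: (h_nseq false n.+1).
  exact: h_false_true.
have [n [w' [-> [->|[v ->]]]]] := nseq_cat_split true w.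
  by rewrite cats0; exact: h_nseq.
elim: n v => [|n IH] v; first exact: h_false.
have := sum_shuffle1_nseq true n (false :: v) h.
rewrite shuffle_h sum_shuffle1 cat_nseq_cons => /esym H.
apply: (h_cancel _ _ _ H) => {H}.
by rewrite big1_seq // => u _; exact: IH.
Qed.

(** * Power series with nonnegative coefficients *)

Section PowerSeries.
Variable R : realType.
Implicit Types (c : nat -> R) (s t : R).
Local Open Scope ereal_scope.

Definition pseries c s : \bar R := \sum_(n <oo) (c n * s ^+ n)%:E.

Lemma pseries_term_ge0 c s n : (forall n, 0 <= c n)%R -> (0 <= s)%R ->
  0 <= (c n * s ^+ n)%:E.
Proof. by move=> c0 s0; rewrite lee_fin mulr_ge0// exprn_ge0. Qed.

Lemma pseries_ge0 c s : (forall n, 0 <= c n)%R -> (0 <= s)%R -> 0 <= pseries c s.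
Proof. by move=> c0 s0; apply: nneseries_ge0 => n _ _; exact: pseries_term_ge0. Qed.

Lemma pseries_recl c s : (forall n, 0 <= c n)%R -> (0 <= s)%R ->
  pseries c s = (c 0%N)%:E + s%:E * pseries (fun n => c n.+1) s.
Proof.
move=> c0 s0; rewrite /pseries nneseries_recl//; last first.
  by move=> n _; exact: pseries_term_ge0.
rewrite expr0 mulr1; congr (_ + _).
have term0 n : 0 <= (c n * s ^+ n)%:E by exact: pseries_term_ge0.
rewrite -(nneseries_addn 1 term0).
rewrite -nneseriesZl; last first.
  by move=> n _; apply: (@pseries_term_ge0 (fun n => c n.+1)).
by apply: eq_eseriesr => n _; rewrite addn1 -EFinM exprS mulrCA.
Qed.

Lemma pseriesD c d s : (forall n, 0 <= c n)%R -> (forall n, 0 <= d n)%R ->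
  (0 <= s)%R ->
  pseries (fun n => c n + d n)%R s = pseries c s + pseries d s.
Proof.
move=> c0 d0 s0; rewrite /pseries -nneseriesD; last 2 first.
- by move=> n _ _; exact: pseries_term_ge0.
- by move=> n _ _; exact: pseries_term_ge0.
by apply: eq_eseriesr => n _; rewrite -EFinD mulrDl.
Qed.

Lemma le_pseries c d s : (forall n, 0 <= c n)%R -> (forall n, c n <= d n)%R ->
  (0 <= s)%R -> pseries c s <= pseries d s.
Proof.
move=> c0 cd s0; rewrite /pseries; apply: lee_nneseries => [n _ _|n _].
  exact: pseries_term_ge0.
by rewrite lee_fin ler_wpM2r// exprn_ge0.
Qed.

Lemma pseries_fin_num c s : (forall n, 0 <= c n)%R -> (0 <= s)%R ->
  (pseries c s \is a fin_num) = (pseries c s < +oo).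
Proof. by move=> c0 s0; rewrite ge0_fin_numE// pseries_ge0. Qed.

(** Multiplication by 1 / (1 - s) turns coefficients into their partial sums: the
    series D of the partial sums satisfies D = C + s D.  As D could a priori be
    infinite, its truncations are first bounded by C / (1 - s), by the truncated
    form of the same equation. *)
Lemma pseries_partial_sums c s : (forall n, 0 <= c n)%R -> (0 <= s < 1)%R ->
  pseries c s < +oo ->
  pseries (fun n => \sum_(m < n.+1) c m)%R s = ((1 - s)^-1)%:E * pseries c s.
Proof.
move=> c0 /andP[s0 s1] cfin.
set d := fun n => _.
have d0 n : (0 <= d n)%R by apply: sumr_ge0.
have s10 : (0 < 1 - s)%R by rewrite subr_gt0.
have dS n : (d n.+1 = c n.+1 + d n)%R by rewrite /d big_ord_recr/= addrC.
have cE : pseries c s \is a fin_num by rewrite pseries_fin_num.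
have dE : pseries d s = pseries c s + s%:E * pseries d s.
  rewrite {1}(pseries_recl d0 s0) (pseries_recl c0 s0).
  rewrite (_ : (fun n => d n.+1) = fun n => c n.+1 + d n)%R; last exact/funext.
  rewrite pseriesD// ge0_muleDr ?pseries_ge0// addeA.
  by congr (_%:E + _ + _); rewrite /d big_ord1.
have dfin : pseries d s \is a fin_num.
  rewrite pseries_fin_num//.
  apply: (@le_lt_trans _ _ (fine (pseries c s) / (1 - s))%:E); last exact: ltry.
  apply: lime_le; first by apply: is_cvg_nneseries => n _ _; exact: pseries_term_ge0.
  apply: nearW => n; rewrite sumEFin lee_fin ler_pdivlMr//.
  have : (\sum_(0 <= i < n) d i * s ^+ i <=
      \sum_(0 <= i < n) c i * s ^+ i + s * \sum_(0 <= i < n) d i * s ^+ i)%R.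
    case: n => [|n]; first by rewrite !big_geq// mulr0 addr0.
    rewrite [X in (X <= _)%R]big_nat_recl// [X in (_ <= X + _)%R]big_nat_recl// -addrA.
    apply: lerD; first by rewrite /d big_ord1.
    rewrite [X in (_ <= _ + _ * X)%R]big_nat_recr//= mulrDr addrA.
    rewrite mulr_sumr -big_split/=.
    rewrite (eq_bigr (fun i => c i.+1 * s ^+ i.+1 + s * (d i * s ^+ i)))%R.
      by rewrite lerDl !mulr_ge0// exprn_ge0.
    by move=> i _; rewrite dS mulrDl [(s * (_ * _))%R]mulrCA -exprS.
  have : (\sum_(0 <= i < n) c i * s ^+ i <= fine (pseries c s))%R.
    rewrite -lee_fin fineK// -sumEFin.
    by apply: nneseries_lim_ge => i _ _; exact: pseries_term_ge0.
  set D := (\sum_(0 <= i < n) d i * _)%R; set C := (\sum_(0 <= i < n) _)%R.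
  move=> CC DC; rewrite mulrBr mulr1 lerBlDr [(D * s)%R]mulrC.
  by apply: (le_trans DC); rewrite lerD2r.
move: dE; rewrite -(fineK dfin) -(fineK cE) -!EFinM -EFinD => -[dE].
congr EFin; apply: (@mulfI _ (1 - s)%R); first by rewrite gt_eqF.
by rewrite mulrA divff ?gt_eqF// mul1r mulrBl mul1r {1}dE addrK.
Qed.

Lemma integral_monomial (n : nat) t : (0 < t)%R ->
  \int[@lebesgue_measure R]_(s in `]0%R, t[) (s ^+ n)%:E
  = (t ^+ n.+1 / n.+1%:R)%:E.
Proof.
move=> t0.
have cX m : continuous (fun s : R => s ^+ m)%R by exact: exprn_continuous.
rewrite integral_itv_bndo_bndc; last first.
  by apply/measurable_EFinP/measurable_funTS; exact: exprn_measurable.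
rewrite integral_itv_obnd_cbnd; last first.
  by apply/measurable_EFinP/measurable_funTS; exact: exprn_measurable.
rewrite (@continuous_FTC2 _ _ (fun s => s ^+ n.+1 / n.+1%:R)%R)//.
- by rewrite expr0n mul0r sube0.
- exact/continuous_subspaceT/cX.
- split.
  + by move=> s _; apply: derivableM => //; exact: exprn_derivable.
  + by apply: cvgM; [apply: cvg_at_right_filter; exact: cX|exact: cvg_cst].
  + by apply: cvgM; [apply: cvg_at_left_filter; exact: cX|exact: cvg_cst].
- move=> s _; rewrite derive1Mr//; last exact: exprn_derivable.
  by rewrite exp_derive1/= mulrAC divff ?mul1r// pnatr_eq0.
Qed.

(** The coefficients are nonnegative, so the exchange of sum and integral is
    valid even where the series diverges at t; in particular t = 1 is allowed.
    The constant coefficient of the primitive is 0 because the inverse of 0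
    is 0. *)
Lemma integral_pseries c t : (forall n, 0 <= c n)%R -> (0 < t)%R ->
  \int[@lebesgue_measure R]_(s in `]0%R, t[) pseries c s =
  pseries (fun n => c n.-1 / n%:R)%R t.
Proof.
move=> c0 t0.
rewrite integral_nneseries//=; last 2 first.
- move=> n; apply/measurable_EFinP/measurable_funTS/measurable_funM => //.
- by move=> n s /=; rewrite in_itv/= => /andP[/ltW s0 _]; exact: pseries_term_ge0.
rewrite pseries_recl; last 2 first.
- by move=> n; rewrite divr_ge0.
- exact: ltW.
rewrite invr0 mulr0 add0e -nneseriesZl; last first.
  by move=> n _; rewrite lee_fin mulr_ge0 ?divr_ge0 ?exprn_ge0// ltW.
apply: eq_eseriesr => n _.
under eq_integral do rewrite EFinM.
rewrite ge0_integralZl_EFin//.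
- rewrite integral_monomial// -!EFinM exprS; congr EFin.
  by rewrite -[in LHS]mulrA mulrCA [in LHS](mulrA (c n)) [in LHS](mulrAC (c n)).
- by move=> s /=; rewrite in_itv/= => /andP[/ltW s0 _]; rewrite lee_fin exprn_ge0.
- by apply/measurable_EFinP/measurable_funTS; exact: exprn_measurable.
Qed.

End PowerSeries.

(** * Iterated integrals as power series *)

Section IteratedIntegral.
Variable R : realType.
Implicit Types (w : seq bool) (t : R).

(** Taylor coefficients at 0 of the multiple polylogarithm of a word, up to the
    sign (-1)^dp: multiplication by dt / (1 - t) takes partial sums, division by t
    shifts, and the primitive divides by the exponent.  For a word that ends with
    [true] the coefficient at n = 0 vanishes, so that dt / t can be integrated. *)
Fixpoint polylog_coef w (n : nat) : R :=
  match w with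
  | [::] => (n == 0%N)%:R
  | a :: w' =>
      (if a then \sum_(m < n) polylog_coef w' m else polylog_coef w' n) / n%:R
  end.

Definition polylog w t : \bar R := pseries (polylog_coef w) t.

(** Coefficients of the integrand of [polylog (a :: w)]. *)
Definition form_coef (a : bool) w (n : nat) : R :=
  if a then \sum_(m < n.+1) polylog_coef w m else polylog_coef w n.+1.

Lemma polylog_coef_ge0 w n : 0 <= polylog_coef w n.
Proof.
elim: w n => [|a w IH] n /=; first exact: ler0n.
by case: a; rewrite mulr_ge0 ?invr_ge0 ?ler0n// sumr_ge0.
Qed.

Lemma form_coef_ge0 a w n : 0 <= form_coef a w n.
Proof.
by case: a; rewrite /form_coef ?sumr_ge0// => *; exact: polylog_coef_ge0.
Qed.

Lemma polylog_coef_cons a w n :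
  polylog_coef (a :: w) n = form_coef a w n.-1 / n%:R.
Proof. by case: n => [|n] //=; rewrite invr0 !mulr0. Qed.

(** The coefficients are divided by n >= 1, so the series of [a :: w] is at most
    that of [w] or that of its partial sums; hence finiteness propagates along
    the word without an estimate of the coefficients. *)
Lemma polylog_fin_num w t : 0 <= t < 1 -> polylog w t \is a fin_num.
Proof.
move=> /andP[t0 t1].
rewrite pseries_fin_num//; last exact: polylog_coef_ge0.
elim: w => [|a w IH].
  rewrite /polylog pseries_recl//.
  by rewrite /pseries eseries0 ?mule0 ?ltry// => n _ _ /=; rewrite mul0r.
have coefS n : polylog_coef (a :: w) n <=
    if a then \sum_(m < n.+1) polylog_coef w m else polylog_coef w n.
  have invr_le1 : n%:R^-1 <= 1 :> R.
    by case: n => [|n]; rewrite ?invr0// invf_le1// ler1n.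
  case: a => /=; last by rewrite ler_piMr// polylog_coef_ge0.
  rewrite (le_trans (ler_piMr _ invr_le1))//.
    by apply: sumr_ge0 => *; exact: polylog_coef_ge0.
  by rewrite big_ord_recr lerDl polylog_coef_ge0.
apply: le_lt_trans (le_pseries _ coefS t0) _ => [n|]; first exact: polylog_coef_ge0.
case: a {coefS} => //.
rewrite pseries_partial_sums ?t0//; last exact: polylog_coef_ge0.
rewrite lte_mul_pinfty// lee_fin invr_ge0 subr_ge0; exact: ltW.
Qed.

(** The condition on the last letter (which is [a] itself when the word is empty)
    excludes dt / t as the innermost form. *)
Lemma pseries_form_coef a w t : last a w -> 0 < t < 1 ->
  pseries (form_coef a w) t = (((-1) ^+ a * form01 a t)%:E * polylog w t)%E.
Proof.
move=> aw /andP[t0 t1]; have t01 : 0 <= t < 1 by rewrite ltW.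
have c0 := polylog_coef_ge0 w.
have Lfin : polylog w t \is a fin_num by exact: polylog_fin_num.
case: a aw => [_|].
  rewrite [LHS]pseries_partial_sums//; last by rewrite -pseries_fin_num ?ltW.
  by rewrite /form01 expr1 mulN1r -invrN opprB.
case: w c0 Lfin => [//|a w c0 Lfin _].
rewrite expr0 mul1r /polylog (pseries_recl c0 (ltW t0)).
rewrite polylog_coef_cons invr0 mulr0 add0e muleA -EFinM.
by rewrite /form01 mulVf ?gt_eqF// mul1e.
Qed.

(** The endpoint t = 1 is included: the inner integrals are only evaluated at
    s < 1, where they are finite, and the outermost integration commutes with
    the sum by monotone convergence.  If both sides are infinite, their real
    values are 0 by convention. *)
Lemma iter_intE w t : last true w -> 0 < t <= 1 ->
  iter_int w t = (-1) ^+ count_mem true w * fine (polylog w t).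
Proof.
elim: w t => [|a w IH] t aw /andP[t0 t1].
  rewrite /= mul1r /polylog pseries_recl//; last exact: ltW.
  by rewrite /pseries eseries0 ?mule0 ?adde0//= => n _ _; rewrite mul0r.
have w_last : last true w by case: w aw {IH} => //.
have d0 := form_coef_ge0 a w.
have -> : polylog (a :: w) t =
    (\int[@lebesgue_measure R]_(s in `]0%R, t[) pseries (form_coef a w) s)%E.
  rewrite integral_pseries//; congr pseries; apply/funext => n.
  exact: polylog_coef_cons.
rewrite [LHS]/=.
set sgn := (-1) ^+ count_mem true (a :: w).
have integrandE s : s \in `]0, t[%classic ->
    (form01 a s * iter_int w s)%:E =
    (sgn%:E * pseries (form_coef a w) s)%E.
  rewrite inE/= in_itv/= => /andP[s0 st].
  have s1 : s < 1 by exact: lt_le_trans t1.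
  have s01 : 0 <= s < 1 by rewrite ltW.
  rewrite pseries_form_coef ?s0// IH ?s0 ?ltW//.
  rewrite -(fineK (polylog_fin_num w s01)) -!EFinM; congr EFin.
  rewrite /sgn /= exprD; set E := (-1) ^+ count_mem true w.
  by case: (a) => /=; ring.
rewrite /Rintegral; under eq_integral => s st do rewrite (integrandE s st).
(* The integrand has constant sign, so the sign comes out of the integral
   whether or not the latter is finite. *)
rewrite {integrandE}/sgn -signr_odd.
case: (odd _); last by rewrite mul1r; under eq_integral do rewrite mul1e.
under eq_integral do rewrite EFinN mulN1e.
rewrite integral_ge0N ?fineN ?mulN1r// => s /=; rewrite in_itv/= => /andP[s0 _].
by rewrite pseries_ge0// ltW.
Qed.

End IteratedIntegral.

(** * Multiple zeta values as nested sums *)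

Section NestedSums.
Variable R : realType.
Implicit Types (ks : seq nat) (c : R).

Definition decreasing_below (n N : nat) : set (seq nat) :=
  [set s | [&& size s == N, path gtn n s & all (leq 1) s]].

Definition decreasing_head (A : set nat) (N : nat) : set (seq nat) :=
  [set s | exists m s',
     [/\ s = m :: s', A m, (1 <= m)%N & decreasing_below m N s']].

Definition nested_term ks (s : seq nat) : R :=
  \prod_(p <- zip s ks) p.1%:R ^- p.2.

Lemma nested_term_ge0 ks s : 0 <= nested_term ks s.
Proof. by apply: prodr_ge0 => p _; rewrite invr_ge0 exprn_ge0. Qed.

(** A decreasing sequence is its head m followed by a decreasing sequence below
    m.  The constant c makes the inner sum an instance of the same statement, in
    which the factor m^-k has been absorbed. *)
Lemma esum_decreasing_head (A : set nat) c k ks : 0 <= c ->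
  \esum_(s in decreasing_head A (size ks)) (c * nested_term (k :: ks) s)%:E =
  \esum_(m in A) if m \in [set m | 1 <= m]%N then
    \esum_(s in decreasing_below m (size ks)) (c * m%:R ^- k * nested_term ks s)%:E
  else 0%E.
Proof.
move=> c0; rewrite -esum_mkcondr esum_esum; last first.
  by move=> m s _ _; rewrite lee_fin !mulr_ge0 ?invr_ge0 ?exprn_ge0 ?nested_term_ge0.
rewrite (@reindex_esum _ _ _ ((A `&` [set m | 1 <= m]%N)
  `*`` (fun m => decreasing_below m (size ks))) _ (fun p => p.1 :: p.2)).
  apply: eq_esum => -[m s] _ /=; congr EFin.
  by rewrite /nested_term /= big_cons /= mulrA.
split.
- by move=> [m s] [[Am m0] ms]; exists m, s.
- by move=> [m s] [m' s'] _ _ /= [-> ->].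
- by move=> _ [m [s [-> Am m0 ms]]]; exists (m, s).
Qed.

Lemma mzv_word_cons k ks :
  mzv_word (k :: ks) = nseq k.-1 false ++ true :: mzv_word ks.
Proof. by rewrite /mzv_word /= cat_rcons. Qed.

Lemma polylog_coef_mzv_word k ks n : (1 <= k)%N ->
  polylog_coef R (mzv_word (k :: ks)) n =
  n%:R ^- k * \sum_(m < n) polylog_coef R (mzv_word ks) m.
Proof.
case: k => // k _; rewrite mzv_word_cons /=.
elim: k => [|k IH] /=; first by rewrite expr1 mulrC.
by rewrite IH mulrAC [in RHS]exprS invfM [_^-1 * _]mulrC.
Qed.

(** The partial sums in [polylog_coef] are, at each letter [true], the nested
    summation over n > m_1 > m_2 > ... > 0. *)
Lemma sum_polylog_coef_mzv_word c ks n : 0 <= c -> all (leq 1) ks ->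
  (1 <= n)%N ->
  (c * \sum_(m < n) polylog_coef R (mzv_word ks) m)%:E =
  \esum_(s in decreasing_below n (size ks)) (c * nested_term ks s)%:E.
Proof.
elim: ks c n => [|k ks IH] c n c0 /=.
  move=> _ n0; have -> : decreasing_below n 0 = [set [::]].
    by apply/seteqP; split => [[]|_ ->].
  rewrite esum_set1 ?lee_fin ?mulr_ge0 ?nested_term_ge0// /nested_term big_nil.
  by case: n n0 => // n _; rewrite big_ord_recl big1 ?addr0.
move=> /andP[k1 ks1] n0.
have -> : decreasing_below n (size ks).+1 = decreasing_head `I_n (size ks).
  apply/seteqP; split => [[//|m s]|_ [m [s [-> mn m0 /and3P[]]]]].
    move=> /and3P[/= ss /andP[nm ms] /andP[m1 s1]].
    by exists m, s; split => //; apply/and3P.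
  by move=> ss ms s1; apply/and3P; split; rewrite /= ?eqSS ?m0 ?ms ?andbT.
rewrite esum_decreasing_head// esum_fset; last 2 first.
- exact: finite_II.
- move=> m _; case: ifP => // _; apply: esum_ge0 => s _.
  by rewrite lee_fin !mulr_ge0 ?invr_ge0 ?exprn_ge0 ?nested_term_ge0.
rewrite -fsbig_ord mulr_sumr -sumEFin; apply: eq_bigr => m _.
rewrite polylog_coef_mzv_word//; have [->|m1] := posnP m.
  by rewrite memNset// big_ord0 !mulr0.
by rewrite mem_set// -IH// ?mulrA// mulr_ge0// invr_ge0 exprn_ge0.
Qed.

Lemma mzv_series k ks : (1 <= k)%N -> all (leq 1) ks ->
  mzv R (k :: ks) = polylog (mzv_word (k :: ks)) (1 : R).
Proof.
move=> k1 ks1; rewrite /polylog /pseries nneseries_esumT; last first.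
  by move=> n; apply: pseries_term_ge0 => //; exact: polylog_coef_ge0.
rewrite /mzv (_ : [set s | _] = decreasing_head [set: nat] (size ks)).
  have := @esum_decreasing_head [set: nat] 1 k ks ler01.
  under eq_esum do rewrite mul1r.
  move=> ->; apply: eq_esum => m _.
  rewrite expr1n mulr1 polylog_coef_mzv_word//; have [->|m1] := posnP m.
    by rewrite memNset// big_ord0 !mulr0.
  rewrite mem_set// sum_polylog_coef_mzv_word ?invr_ge0 ?exprn_ge0//.
  by under eq_esum do rewrite mul1r.
apply/seteqP; split => [[//|m s]|_ [m [s [-> _ m0 /and3P[]]]]].
  move=> /and3P[/= ss ms /andP[m1 s1]].
  by exists m, s; split => //; apply/and3P.
by move=> ss ms s1; apply/and3P; split => //=; rewrite m0.
Qed.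

Lemma convergent_word_mzv w :
  exists k ks, [/\ (2 <= k)%N, all (leq 1) ks &
    false :: rcons w true = mzv_word (k :: ks)].
Proof.
suff [k [ks [k1 ks1 e]]] : exists k ks, [/\ (1 <= k)%N, all (leq 1) ks &
    rcons w true = mzv_word (k :: ks)].
  exists k.+1, ks; split=> //; rewrite e !mzv_word_cons.
  by case: k k1 {e}.
elim: w => [|a w [k [ks [k1 ks1 e]]]]; first by exists 1%N, [::].
rewrite /= e; case: a; first by exists 1%N, (k :: ks); split=> //=; rewrite k1.
by exists k.+1, ks; split=> //; rewrite !mzv_word_cons; case: k k1 {e}.
Qed.

End NestedSums.

Lemma count_shuffle (T : eqType) (p : pred T) (v w u : seq T) :
  u \in shuffle v w -> count p u = (count p v + count p w)%N.
Proof.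
elim: v w u => [|x v IHv] w u; first by rewrite mem_seq1 => /eqP ->.
elim: w u => [|y w IHw] u; first by rewrite mem_seq1 => /eqP ->; rewrite addn0.
rewrite mem_cat => /orP[] /mapP[u' u'P ->] /=.
  by rewrite (IHv _ _ u'P) addnA.
by rewrite (IHw _ u'P) /= addnCA addnA.
Qed.

(** The sign is a shuffle character because all the shuffles of two words have the
    same letters; on a convergent word it comes from dt / (t - 1) =
    - dt / (1 - t). *)
Lemma reg_int_zeta (R : realType) (zeta J : seq bool -> R) :
  is_zeta_sh zeta -> is_reg_int J ->
  forall w, J w = (-1) ^+ count_mem true w * zeta w.
Proof.
move=> hz hJ; apply: shuffle_character_eq.
- exact: reg_int_shuffle.
- move=> v w; rewrite mulrACA zeta_sh_shuffle// mulr_sumr -exprD.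
  by apply: eq_big_seq => u /count_shuffle ->.
- exact: reg_int_nil.
- by rewrite zeta_sh_nil// mulr1.
- exact: reg_int_single.
- by case; rewrite ?zeta_sh_X0 ?zeta_sh_X1 ?mulr0.
- move=> w; rewrite reg_int_conv// iter_intE ?last_rcons ?ltr01//=; last first.
    by rewrite last_rcons.
  have [k [ks [k2 ks1 ->]]] := convergent_word_mzv w.
  by rewrite -mzv_series ?(ltnW k2)// -(zeta_sh_mzv hz).
Qed.

(** * Substitution and the quotient map *)

Lemma ncscaleE (T : Type) (K : comPzRingType) (a : K) (f : ncseries T K) w :
  (a *: f) w = a * f w.
Proof. by []. Qed.

Section LinearSubstitution.
Variables (T : finType) (K : fieldType).
Implicit Types (f : ncseries T K) (w : seq T).

Lemma hpart_eq n f w : hpart n f = f -> size w != n -> f w = 0.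
Proof. by move=> <- /negPf wn; rewrite /hpart wn. Qed.

(** A product of series concentrated in degree 1 is evaluated at a word letter by
    letter. *)
Lemma prod_linear (A : bool -> ncseries T K) (W : seq bool) w :
  (forall a, hpart 1 (A a) = A a) ->
  (\prod_(a <- W) A a) w =
  if size w == size W then \prod_(p <- zip w W) A p.2 [:: p.1] else 0.
Proof.
move=> A1; elim: W w => [|a W IH] w.
  by rewrite big_nil; case: w => //=; rewrite big_nil.
rewrite big_cons; case: w => [|x w].
  by rewrite [LHS]ncmul_nil (hpart_eq (A1 a)) ?mul0r.
rewrite [LHS]ncmul_cons (hpart_eq (A1 a)) // mul0r add0r.
have -> : ncshift x (A a) = A a [:: x] *: (1 : ncseries T K).
  apply/funext => -[|y u]; first by apply/esym/mulr1.
  by rewrite [RHS]mulr0 /ncshift (hpart_eq (A1 a)).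
rewrite [ncmul _ _]ncmulZl mul1r ncscaleE IH.
rewrite -[size (x :: w) == _]/(size w == size W).
rewrite -[zip (x :: w) _]/((x, a) :: zip w W) big_cons.
by case: ifP => // _; rewrite mulr0.
Qed.

Lemma ncsubst_linear (F : ncseries bool K) (A : bool -> ncseries T K) w :
  (forall a, hpart 1 (A a) = A a) ->
  ncsubst F A w = \sum_(W : (size w).-tuple bool)
    F W * \prod_(p <- zip w W) A p.2 [:: p.1].
Proof.
move=> A1; rewrite /ncsubst big_ord_recr /= big1 ?add0r => [|n _].
  by apply: eq_bigr => W _; rewrite prod_linear // size_tuple eqxx.
rewrite big1 // => W _; rewrite prod_linear // size_tuple.
by rewrite gtn_eqF ?mulr0 // (leq_trans (ltn_ord n)).
Qed.

Lemma hpart_ncsubst n (F : ncseries bool K) (A : bool -> ncseries T K) :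
  (forall a, hpart 1 (A a) = A a) ->
  hpart n (ncsubst F A) = \sum_(W : n.-tuple bool) F W *: \prod_(a <- W) A a.
Proof.
move=> A1; apply/funext => w; rewrite ncsumE /hpart.
have [<-|nw] := eqVneq; last first.
  rewrite big1 // => W _.
  by rewrite ncscaleE prod_linear // size_tuple (negPf nw) mulr0.
rewrite ncsubst_linear //; apply: eq_bigr => W _.
by rewrite ncscaleE prod_linear // size_tuple eqxx.
Qed.

End LinearSubstitution.

Section QuotientMap.
Variables (T : finType) (K : fieldType) (rel : ncseries T K -> Prop).
Local Notation U := (completed_quotient rel).
Local Notation pi := (ncproj rel).

Lemma ncproj0 : pi 0 = 0.
Proof. by apply: (@addrI _ (pi 0)); rewrite -ncprojD !addr0. Qed.

Lemma ncproj1 : pi 1 = 1. Proof. by []. Qed.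

Lemma ncproj_sum (I : Type) (s : seq I) (P : pred I) (F : I -> ncseries T K) :
  pi (\sum_(i <- s | P i) F i) = \sum_(i <- s | P i) pi (F i).
Proof. exact: (big_morph pi (@ncprojD _ _ _) ncproj0). Qed.

Lemma ncproj_prod (I : Type) (s : seq I) (P : pred I) (F : I -> ncseries T K) :
  pi (\prod_(i <- s | P i) F i) = \prod_(i <- s | P i) pi (F i).
Proof. exact: (big_morph pi (@ncprojM _ _ _) ncproj1). Qed.

Lemma ncprojZE a f : pi (a *: f) = a *: pi f.
Proof. exact: ncprojZ. Qed.

Lemma qhpart_inj (x y : U) : (forall n, qhpart n x = qhpart n y) -> x = y.
Proof.
have [f ->] := ncproj_repr x; have [g ->] := ncproj_repr y => fg.
apply/ncproj_eq/asboolP => n; have := fg n.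
rewrite !qhpartE => /ncproj_eq; rewrite -hpartB => /asboolP /(_ n).
by rewrite hpartK eqxx.
Qed.

(** In each degree the substitution is a finite sum of products, which the
    quotient map respects. *)
Lemma ncproj_ncsubst_eq (F : ncseries bool K) (A A' : bool -> ncseries T K) :
  (forall a, hpart 1 (A a) = A a) -> (forall a, hpart 1 (A' a) = A' a) ->
  (forall a, pi (A a) = pi (A' a)) ->
  pi (ncsubst F A) = pi (ncsubst F A').
Proof.
move=> A1 A'1 AA'; apply: qhpart_inj => n.
rewrite !qhpartE !hpart_ncsubst // !ncproj_sum; apply: eq_bigr => W _.
by rewrite !ncprojZE !ncproj_prod; under eq_bigr do rewrite AA'.
Qed.

Lemma ncproj_rel n r : rel r -> hpart n r = r -> pi r = 0.
Proof.
move=> rr rn; rewrite -ncproj0; apply/ncproj_eq; rewrite subr0.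
apply/asboolP => m; rewrite -rn hpartK; case: ifP => _; last exact: ideal_gen0.
rewrite rn -[r]addr0 -[r]mul1r -[1 * r]mulr1 -ncword0 -[X in X + _]scale1r.
by apply: ideal_genD => //; exact: ideal_gen0.
Qed.

End QuotientMap.

(** * The relations of U B_5 in degree one *)

Section UB5.
Variable K : fieldType.
Local Notation x i j := (ncproj (@rel5 K) (X5 K i j)).

Lemma hpart_ncword (T : eqType) (u : seq T) :
  hpart (size u) (ncword K u) = ncword K u.
Proof.
apply/funext => w; rewrite /hpart /ncword; case: eqP => // wu.
by case: eqP => // e; rewrite e in wu.
Qed.

Lemma hpart_X5 i j : hpart 1 (X5 K i j) = X5 K i j.
Proof. exact: (hpart_ncword [:: (i, j)]). Qed.

Lemma hpart_sum (T : eqType) n (I : Type) (s : seq I) (P : pred I)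
    (F : I -> ncseries T K) :
  hpart n (\sum_(i <- s | P i) F i) = \sum_(i <- s | P i) hpart n (F i).
Proof.
elim/big_rec2: _ => [|i y z _ <-]; first by apply/funext => w; rewrite /hpart; case: ifP.
by apply/funext => w; rewrite /hpart; case: ifP => // e; rewrite ncfE e ?addr0.
Qed.

Lemma UB5_diag i : x i i = 0.
Proof. by apply: (@ncproj_rel _ _ _ 1); [exact: rel5_diag | exact: hpart_X5]. Qed.

Lemma UB5_sym i j : x i j = x j i.
Proof.
apply/eqP; rewrite -subr_eq0 -raddfB /=; apply/eqP.
apply: (@ncproj_rel _ _ _ 1); first exact: rel5_sym.
by rewrite hpartB !hpart_X5.
Qed.

Lemma UB5_sum i : \sum_j x i j = 0.
Proof.
rewrite -ncproj_sum; apply: (@ncproj_rel _ _ _ 1); first exact: rel5_sum.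
by rewrite hpart_sum; under eq_bigr do rewrite hpart_X5.
Qed.

(** The relations of the rows 2, 3 and 4 add up to 2 S + (the terms X_{i5} and
    X_{i1} with i in {2, 3, 4}) = 0, where S is the left-hand side; by the rows 5
    and 1 these terms add up to - 2 X_51. *)
Lemma UB5_51 : (2 : K) != 0 -> x 3 4 + x 2 4 + x 2 3 = x 5 1.
Proof.
move=> K2.
have sumE i : x i 0 + x i 1 + x i 2 + x i 3 + x i 4 = 0.
  rewrite -[RHS](UB5_sum i) !big_ord_recl big_ord0 addr0 !addrA.
  by do !congr (_ + x _ _); apply: val_inj.
have row0 := sumE 0; have row1 := sumE 1; have row2 := sumE 2.
have row3 := sumE 3; have row4 := sumE 4.
rewrite !UB5_diag ?addr0 ?add0r in row0 row1 row2 row3 row4.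
rewrite ?(UB5_sym _ 0) ?(UB5_sym 2 1) ?(UB5_sym 3 1) ?(UB5_sym 4 1)
  ?(UB5_sym 3 2) ?(UB5_sym 4 2) ?(UB5_sym 4 3) in row0 row1 row2 row3 row4 *.
have -> : (5 : 'I_5) = 0 by exact: val_inj.
set S := _ + x 2 3.
have e0 : x 0 2 + x 0 3 + x 0 4 = - x 0 1.
  by apply/eqP; rewrite -addr_eq0 addrC !addrA row0.
have e1 : x 1 2 + x 1 3 + x 1 4 = - x 0 1.
  by apply/eqP; rewrite -addr_eq0 addrC !addrA row1.
have : S + S + (x 0 2 + x 0 3 + x 0 4) + (x 1 2 + x 1 3 + x 1 4) = 0.
  rewrite /S (+%R).[AC (3*3*3*3) ((7*10*3*2)*(8*11*6*1)*(9*12*5*4))].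
  by rewrite row2 row3 row4 !addr0.
rewrite e0 e1 -addrA addrACA -mulr2n -[X in X = _]scaler_nat => /eqP.
by rewrite scaler_eq0 (negPf K2) subr_eq0 => /eqP.
Qed.

End UB5.

(** * Generating series of the integrals along the paths *)

Section Paths.
Variable R : realType.
Local Notation C := R[i].
Local Notation x i j := (ncproj (@rel5 C) (X5 C i j)).

(** The coefficient of dt/t ([false]) or dt/(t-1) ([true]) in the restriction to
    D_ji of the one-form sum_g omega_g X_g. *)
Definition path_letter (j i : 'I_5) (a : bool) : ncseries gen5 C :=
  fun w => if w is [:: g] then Reg j i (omega R g) a else 0.

Lemma hpart_path_letter j i a : hpart 1 (path_letter j i a) = path_letter j i a.
Proof. by apply/funext => -[|g [|h w]]. Qed.

Lemma big_zip_map (S T V : Type) (M : comPzSemiRingType) (h : S -> T)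
    (F : T -> V -> M) (s : seq S) (v : seq V) :
  \prod_(p <- zip (map h s) v) F p.1 p.2 = \prod_(p <- zip s v) F (h p.1) p.2.
Proof.
elim: s v => [|y s IH] [|z v] /=; rewrite ?big_nil //.
by rewrite !big_cons IH.
Qed.

(** Both sides at w are the sum over the binary words v of J(v) times the product
    of the coefficients of v_k in the restriction of omega_{w_k}. *)
Lemma path_int_omega (zeta J : seq bool -> R) j i w :
  is_zeta_sh zeta -> is_reg_int J ->
  path_int J j i (map (omega R) w) = ncsubst (PhiKZ zeta) (path_letter j i) w.
Proof.
move=> hz hJ; rewrite (path_intE _ _ _ (size_map _ _)) ncsubst_linear; last first.
  exact: hpart_path_letter.
apply: eq_bigr => v _; rewrite mulrC (reg_int_zeta hz hJ); congr (_ * _).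
  by rewrite rmorphM rmorphXn rmorphN1.
by rewrite (big_zip_map _ (fun eta a => Reg j i eta a)).
Qed.

Definition ncmap (S T : Type) (h : S -> T) (f : ncseries T C) : ncseries S C :=
  fun w => f (map h w).

Lemma ncmapM (S T : Type) (h : S -> T) (f g : ncseries T C) :
  ncmap h (f * g) = ncmap h f * ncmap h g.
Proof.
apply/funext => w; rewrite /ncmap !ncME size_map.
by apply: eq_bigr => k _; rewrite map_take map_drop.
Qed.

Lemma Reg0 j i : Reg j i (0 : H1 R) = 0.
Proof. by rewrite /Reg big1 // => c _; rewrite ffunE scale0r. Qed.

Lemma omega_notin g : g \notin lettersA -> omega R g = 0.
Proof. by rewrite !inE /omega; do 5 case: (g == _) => //=; rewrite ?orbT. Qed.

Lemma ncproj_path_letter j i a :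
  ncproj (@rel5 C) (path_letter j i a) =
  \sum_(g <- lettersA) Reg j i (omega R g) a *: ncproj _ (ncword C [:: g]).
Proof.
have -> : path_letter j i a =
    \sum_(g : gen5) Reg j i (omega R g) a *: ncword C [:: g].
  apply/funext => w; rewrite ncsumE.
  case: w => [|h [|h' w]]; last 1 first.
  - rewrite big1 // => g _; rewrite ncscaleE /ncword /=.
    by rewrite eqseq_cons andbF mulr0.
  - by rewrite big1 // => g _; rewrite ncscaleE /ncword mulr0.
  - rewrite (bigD1 h) //= big1 => [|g gh].
      by rewrite ncscaleE /ncword eqxx mulr1 addr0.
    by rewrite ncscaleE /ncword eqseq_cons eq_sym (negPf gh) mulr0.
rewrite ncproj_sum; under eq_bigr do rewrite ncprojZE.
rewrite (bigID (mem lettersA)) /= [X in _ + X]big1 ?addr0 => [|g gA].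
  by rewrite big_uniq.
by rewrite omega_notin // Reg0 ffunE scale0r.
Qed.

Lemma RegD j i (eta eta' : H1 R) : Reg j i (eta + eta') = Reg j i eta + Reg j i eta'.
Proof.
by rewrite /Reg -big_split; apply: eq_bigr => c _; rewrite ffunE scalerDl.
Qed.

Lemma Reg_dlogu j i k l : l == k + 2 ->
  Reg j i (dlogu R k l) = dlog_restr R
    (match (i == k) || (i == l), (j == k) || (j == l) with
     | true, true => RestrZero | false, false => RestrOne
     | true, false => RestrT | false, true => Restr1T end).
Proof.
move=> kl; pose c : chord := exist _ (k, l) kl.
have -> : dlogu R k l = dlogc R c.
  apply/ffunP => d; rewrite !ffunE; congr (_%:R).
  have -> : (val d == (l, k)) = false.
    case: d => -[k' l'] /= kl'; apply/negP => /eqP[e1 e2]; move: (kl) kl'.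
    rewrite e1 e2 /= => /eqP -> /eqP /esym /eqP.
    by rewrite -addrA -[X in _ == X]addr0 (inj_eq (addrI _)).
  by rewrite orbF.
by rewrite Reg_dlogc /restr /on_chord.
Qed.

Lemma dlogu_sym k l : dlogu R k l = dlogu R l k.
Proof. by apply/ffunP => c; rewrite !ffunE orbC. Qed.

(** On the paths p_24 and p_13 one letter is the sum X_34 + X_24 + X_23, because
    log u_14 occurs in the three forms omega_34, omega_24 and omega_23. *)
Lemma ncproj_path_letters a :
  [/\ ncproj (@rel5 C) (path_letter 3 5 a) = if a then x 2 3 else x 1 2,
      ncproj (@rel5 C) (path_letter 5 2 a) = if a then x 4 5 else x 3 4,
      ncproj (@rel5 C) (path_letter 2 4 a) = if a then x 1 2 else x 5 1,
      ncproj (@rel5 C) (path_letter 4 1 a) = if a then x 3 4 else x 2 3 &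
      ncproj (@rel5 C) (path_letter 1 3 a) = if a then x 5 1 else x 4 5].
Proof.
have C2 : (2 : C) != 0 by rewrite pnatr_eq0.
split; rewrite ncproj_path_letter /lettersA !big_cons big_nil /omega /=;
  rewrite (dlogu_sym 1 4) (dlogu_sym 2 5) ?RegD ?Reg_dlogu //;
  case: a => /=; rewrite !ffunE /= ?(addr0, add0r, scale0r, scale1r) //;
  by rewrite ?addrA UB5_51.
Qed.

Lemma PhiKZ_UB5_path (zeta J : seq bool -> R) (j i k l m n : 'I_5) :
  is_zeta_sh zeta -> is_reg_int J ->
  (forall a, ncproj (@rel5 C) (path_letter j i a) =
             if a then x m n else x k l) ->
  ncproj (@rel5 C) (ncmap (omega R) (path_int J j i)) =
  PhiKZ_UB5 zeta k l m n.
Proof.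
move=> hz hJ ijE.
have -> : ncmap (omega R) (path_int J j i) =
    ncsubst (PhiKZ zeta) (path_letter j i).
  by apply/funext => w; exact: path_int_omega.
apply: ncproj_ncsubst_eq => [a|a|a]; first exact: hpart_path_letter.
  by case: a; exact: hpart_X5.
by rewrite ijE; case: a.
Qed.

Lemma ncproj_gamma_int (zeta J : seq bool -> R) :
  is_zeta_sh zeta -> is_reg_int J ->
  ncproj (@rel5 C) (ncmap (omega R) (gamma_int_pure J)) =
  PhiKZ_UB5 zeta 1 2 2 3 * PhiKZ_UB5 zeta 3 4 4 5 * PhiKZ_UB5 zeta 5 1 1 2
    * PhiKZ_UB5 zeta 2 3 3 4 * PhiKZ_UB5 zeta 4 5 5 1.
Proof.
move=> hz hJ; rewrite /gamma_int_pure !ncmapM !ncprojM.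
have mulE (p p' q q' : UB5 C) : p = p' -> q = q' -> p * q = p' * q'.
  by move=> -> ->.
do 4?[apply: (mulE)];
  apply: (PhiKZ_UB5_path hz hJ) => a; by case: (ncproj_path_letters a).
Qed.

End Paths.

(** * Expansions on a basis *)

Section BasisExpansion.
Variables (T : finType) (K : fieldType) (rel : ncseries T K -> Prop).
Local Notation U := (completed_quotient rel).
Local Notation pi := (ncproj rel).
Variables (B : set U) (hB : is_basis B).
Implicit Types (x b : U) (a : U -> K).

Lemma fsum_support (I : choiceType) (M : nmodType) (D E : set I) (F : I -> M) :
  D `<=` E -> (forall i, E i -> ~ D i -> F i = 0) ->
  \sum_(i \in E) F i = \sum_(i \in D) F i.
Proof. by move=> DE F0; apply/esym/fsbig_widen => // i [Ei Di]; exact: F0. Qed.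

Lemma qhpartD n x y : qhpart n (x + y) = qhpart n x + qhpart n y.
Proof.
have [f ->] := ncproj_repr x; have [g ->] := ncproj_repr y.
rewrite -ncprojD !qhpartE -ncprojD; congr ncproj.
by apply/funext => w; rewrite ncfE /hpart; case: ifP; rewrite ?addr0.
Qed.

Lemma qhpartZ n (c : K) x : qhpart n (c *: x) = c *: qhpart n x.
Proof.
by have [f ->] := ncproj_repr x; rewrite -ncprojZE !qhpartE hpartZ -ncprojZE.
Qed.

Lemma qhpart0 n : qhpart n (0 : U) = 0.
Proof. by rewrite -[0 in LHS](scale0r (0 : U)) qhpartZ scale0r. Qed.

Lemma qhpart_sum n (I : Type) (s : seq I) (P : pred I) (F : I -> U) :
  qhpart n (\sum_(i <- s | P i) F i) = \sum_(i <- s | P i) qhpart n (F i).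
Proof. exact: (big_morph _ (@qhpartD n) (qhpart0 n)). Qed.

Lemma qhpartK m n x : qhpart m (qhpart n x) = if m == n then qhpart n x else 0.
Proof.
have [f ->] := ncproj_repr x; rewrite !qhpartE hpartK.
by case: ifP => // _; exact: ncproj0.
Qed.

Lemma qhomog_hpart m n x : qhomog n x -> qhpart m x = if m == n then x else 0.
Proof. by move=> xn; rewrite -{1}xn qhpartK xn. Qed.

Lemma qhomog1 : qhomog 0 (1 : U).
Proof.
rewrite /qhomog /= -ncproj1 qhpartE; congr ncproj.
by apply/funext => -[|y w].
Qed.

Lemma lincomb_self b : B b -> is_lincomb B (fun b' => (b' == b)%:R) b.
Proof.
move=> Bb; split.
  apply: (@sub_finite_set _ _ [set b]); last exact: finite_set1.
  by move=> b' [_] /=; case: (eqVneq b' b) => //; rewrite eqxx.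
rewrite (@fsum_support _ _ [set b]); last 2 first.
- by move=> _ ->.
- by move=> b' _ /eqP /negPf ->; rewrite scale0r.
by rewrite fsbig_set1 eqxx scale1r.
Qed.

Lemma basis_neq0 b : B b -> b <> 0.
Proof.
move=> Bb b0; have H := lincomb_self Bb; rewrite {2}b0 in H.
have H0 : is_lincomb B (fun=> 0) (0 : U).
  split; last by rewrite fsbig1 // => b' _; rewrite scale0r.
  by apply: (@sub_finite_set _ _ set0) => // b' [_]; rewrite eqxx.
have := basis_poly_unique hB H H0 Bb.
by move/eqP; rewrite eqxx oner_eq0.
Qed.

Lemma qhomog_basis_inj m n b : B b -> qhomog m b -> qhomog n b -> m = n.
Proof.
move=> Bb bm bn; apply/eqP; apply: contra_notT (basis_neq0 Bb) => mn.
by rewrite -bm (qhomog_hpart m bn) (negPf mn).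
Qed.

Lemma coord_lincomb x : Defs.qpoly x -> is_lincomb B (Defs.coord B x) x.
Proof.
move=> /(basis_poly hB) [a xa]; rewrite /Defs.coord.
by case: xgetP => [a' _ //|/(_ a)].
Qed.

(** The projection to degree n of an expansion of x is again an expansion of x, so
    uniqueness forces the coefficients in the other degrees to vanish. *)
Lemma coord_homog n x b : Defs.qpoly x -> qhomog n x -> B b -> Defs.coord B x b != 0 ->
  qhomog n b.
Proof.
move=> px xn Bb; have [fin xE] := coord_lincomb px; apply: contra_neqP => bn.
pose a b' := if `[< qhomog n b' >] then Defs.coord B x b' else 0.
have xa : is_lincomb B a x.
  set D := [set b | _] in fin.
  split.
    apply: sub_finite_set fin => b' [Bb']; rewrite /a; case: asboolP => // _.
    by rewrite eqxx.
  have DB : D `<=` B by move=> ? [].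
  have D0 b' : B b' -> ~ D b' -> Defs.coord B x b' = 0.
    by move=> Bb' /not_andP[//|/negP]; rewrite negbK => /eqP.
  rewrite -{1}xn {1}xE !(fsum_support DB).
  - rewrite !fsbig_finite // qhpart_sum; apply: eq_big_seq => b' b'D.
    have {b'D} [Bb' _] : D b' by move: b'D; rewrite in_fset_set // inE.
    rewrite qhpartZ /a; have [_ [m b'm]] := basis_homog hB Bb'.
    rewrite (qhomog_hpart n b'm); case: asboolP => [b'n|b'n].
      by rewrite (qhomog_basis_inj Bb' b'm b'n) eqxx.
    by case: eqP => [e|_]; [rewrite e in b'n | rewrite scaler0 scale0r].
  - by move=> b' Bb' Db'; rewrite /a D0 // if_same scale0r.
  - by move=> b' Bb' Db'; rewrite D0 // scale0r.
rewrite (basis_poly_unique hB (coord_lincomb px) xa Bb) /a.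
by case: asboolP.
Qed.

Lemma qpoly_word (u : seq T) : Defs.qpoly (pi (ncword K u)).
Proof.
exists (ncword K u) => //; apply: (@sub_finite_set _ _ [set u]) => // w /=.
by rewrite /ncword; case: (eqVneq w u) => //; rewrite eqxx.
Qed.

Lemma qhomog_word (u : seq T) : qhomog (size u) (pi (ncword K u)).
Proof. by rewrite /qhomog /= qhpartE hpart_ncword. Qed.

(** In degree n only the finitely many words of length n contribute, each with
    finitely many coordinates, so that the two summations can be exchanged
    over a finite set D of basis elements. *)
Lemma qhpart_basis n (f : ncseries T K) :
  qhpart n (pi f) = \sum_(b \in B `&` qhomog n)
    (\sum_(u : n.-tuple T) f u * Defs.coord B (pi (ncword K u)) b) *: b.
Proof.
pose D := \bigcup_(u in [set: n.-tuple T])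
  [set b | B b /\ Defs.coord B (pi (ncword K u)) b != 0].
have Dfin : finite_set D.
  by apply: bigcup_finite => // u _; have [] := coord_lincomb (qpoly_word u).
have Dn : D `<=` B `&` qhomog n.
  move=> b [u _ [Bb ub]]; split=> //.
  apply: (coord_homog (qpoly_word u)) => //.
  by rewrite -[X in qhomog X](size_tuple u); exact: qhomog_word.
have D0 b (u : n.-tuple T) : B b -> ~ D b -> Defs.coord B (pi (ncword K u)) b = 0.
  by move=> Bb Db; apply: contra_notP Db => /eqP ub; exists u.
rewrite qhpartE hpart_words ncproj_sum (fsum_support Dn); last first.
  by move=> b [Bb _] Db; rewrite big1 ?scale0r // => u _; rewrite D0 // mulr0.
have wordE (u : n.-tuple T) : pi (ncword K u) =
    \sum_(b \in D) Defs.coord B (pi (ncword K u)) b *: b.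
  have [_ {1}->] := coord_lincomb (qpoly_word u).
  apply: fsum_support; first by move=> b /Dn[].
  by move=> b Bb Db; rewrite D0 // scale0r.
under eq_bigr => u _ do rewrite ncprojZE wordE fsbig_finite // scaler_sumr.
rewrite exchange_big fsbig_finite //=; apply: eq_bigr => b _.
by rewrite scaler_suml; apply: eq_bigr => u _; rewrite scalerA.
Qed.

Lemma series_one : is_series B (fun b => (b == 1)%:R) 1.
Proof.
move=> n; rewrite (qhomog_hpart n qhomog1); case: eqP => [->|n0].
  by rewrite (basis_deg0 hB) fsbig_set1 eqxx scale1r.
rewrite fsbig1 // => b [Bb bn]; case: eqP => [b1|_]; last by rewrite scale0r.
by case: n0; apply: (qhomog_basis_inj Bb bn); rewrite b1; exact: qhomog1.
Qed.

Lemma basis_one : B 1.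
Proof. by have [] : (B `&` qhomog 0) 1 by rewrite (basis_deg0 hB). Qed.

Lemma series_eq_one a x : is_series B a x -> a 1 = 1 ->
  x = 1 <-> (forall b, B b -> b <> 1 -> a b = 0).
Proof.
move=> xa a1; split=> [x1 b Bb /eqP b1|a0].
  rewrite x1 in xa; rewrite (basis_series_unique hB xa series_one Bb).
  by rewrite (negPf b1).
apply: qhpart_inj => n; rewrite xa series_one; apply: eq_fsbigr => b.
rewrite inE => -[Bb _]; congr (_ *: _).
by case: eqP => [->|b1]; [exact: a1 | exact: a0].
Qed.

End BasisExpansion.

(** * Integrals of the dual basis *)

Section DualBasis.
Variable R : realType.
Local Notation C := R[i].
Variable J : seq bool -> R.
Local Notation pi := (ncproj (@rel5 C)).

Lemma fsum_words (T : finType) (M : nmodType) n (F : seq T -> M) :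
  (forall w, size w != n -> F w = 0) ->
  \sum_(w \in [set: seq T]) F w = \sum_(u : n.-tuple T) F u.
Proof.
move=> F0; rewrite (fsbigE (map val (enum {: n.-tuple T}))) //.
- by under eq_bigl do rewrite in_setT; rewrite big_map big_enum.
- by rewrite map_inj_uniq ?enum_uniq //; exact: val_inj.
- move=> w _ wn; apply: F0; apply: contra wn => wn.
  by apply/mapP; exists (Tuple wn); rewrite ?mem_enum.
Qed.

Lemma gamma_int_homogeneous n (tau : ncseries chord C) :
  (forall c, size c != n -> tau c = 0) ->
  gamma_int J tau =
  \sum_(c : n.-tuple chord) tau c * gamma_int_pure J (map (dlogc R) c).
Proof.
by move=> tau0; apply: fsum_words => c /tau0 ->; rewrite mul0r.
Qed.

Lemma bar_size (s : seq (H1 R)) c : size c != size s -> bar s c = 0.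
Proof. by rewrite /bar => /negPf ->. Qed.

Lemma gamma_int_omega_notin (u : seq gen5) :
  ~~ all (mem lettersA) u -> gamma_int_pure J (map (omega R) u) = 0.
Proof.
move=> /allPn[g + gA]; case/splitPr => u1 u2.
rewrite map_cat /= omega_notin // (gamma_int_pure_slot_linear J _ 0).
by rewrite big1 // => c _; rewrite ffunE mul0r.
Qed.

Variables (B : set (UB5 C)) (hB : is_basis B).

(** The words in b^* have the degree of b.  The sum on the right runs over all the
    words of length n: those with a letter outside the alphabet have an integral
    equal to 0, as omega is 0 there. *)
Lemma gamma_int_dual_elt n b : B b -> qhomog n b ->
  gamma_int J (dual_elt B b) = \sum_(u : n.-tuple gen5)
    ncmap (omega R) (gamma_int_pure J) u * Defs.coord B (pi (ncword C u)) b.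
Proof.
move=> Bb bn.
pose l u := Defs.coord B (pi (ncword C u)) b.
have l0 u : size u != n -> l u = 0.
  apply: contraNeq => /(coord_homog hB (qpoly_word _ u) (qhomog_word _ u) Bb) bu.
  by rewrite (qhomog_basis_inj hB Bb bu bn).
have -> : dual_elt B b =
    \sum_(u : n.-tuple gen5 | all (mem lettersA) u) l u *: bar (map (omega R) u).
  rewrite /dual_elt fsbig_mkcond (@fsum_words _ _ n) => [|w wn].
    rewrite [RHS]big_mkcond; apply: eq_bigr => u _.
    rewrite /patch; congr (if _ then _ else _).
    by apply/idP/idP; rewrite inE.
  by rewrite /patch; case: ifP => // _; rewrite -/(l w) l0 // scale0r.
rewrite (@gamma_int_homogeneous n) => [|c cn]; last first.
  rewrite ncsumE big1 // => u _.
  by rewrite ncscaleE bar_size ?mulr0 // size_map size_tuple.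
under eq_bigr => c _ do rewrite ncsumE mulr_suml.
rewrite exchange_big [RHS](bigID (fun u => all (mem lettersA) (tval u))) /=.
rewrite [X in _ + X]big1 ?addr0 => [|u uA]; last first.
  by rewrite /ncmap gamma_int_omega_notin // mul0r.
apply: eq_bigr => u _; rewrite mulrC -/(l u) /ncmap -gamma_int_bar.
rewrite (@gamma_int_homogeneous n) => [|c cn]; last first.
  by rewrite bar_size // size_map size_tuple.
by rewrite mulr_sumr; apply: eq_bigr => c _; rewrite ncscaleE mulrA.
Qed.

(** The integrals of the dual basis elements are the coefficients on B of the
    generating series of the integrals along gamma. *)
Lemma gamma_int_series :
  is_series B (fun b => gamma_int J (dual_elt B b))
    (pi (ncmap (omega R) (gamma_int_pure J))).
Proof.
move=> n; rewrite (qhpart_basis hB); apply: eq_fsbigr => b.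
by rewrite inE => -[Bb bn]; rewrite (gamma_int_dual_elt Bb bn).
Qed.

Lemma gamma_int_dual_one : is_reg_int J -> gamma_int J (dual_elt B 1) = 1.
Proof.
move=> hJ; have path1 j i : path_int J j i [::] = 1.
  rewrite (path_intE J j i (erefl (size [::]))) (big_pred1 [tuple]) => [|v].
    by rewrite big_nil mul1r reg_int_nil.
  exact/esym/eqP/tuple0.
have mul_nil (f g : ncseries (H1 R) C) : (f * g) [::] = f [::] * g [::].
  exact: ncmul_nil.
have := gamma_int_series 0.
rewrite (basis_deg0 hB) fsbig_set1 qhpartE.
have -> : hpart 0 (ncmap (omega R) (gamma_int_pure J)) = 1.
  apply/funext => -[|g w] //; rewrite /hpart /= /ncmap /gamma_int_pure.
  by rewrite !mul_nil !path1 !mulr1.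
move/eqP; rewrite ncproj1 -subr_eq0 -[X in X - _]scale1r -scalerBl scaler_eq0.
move=> /orP[|/eqP/(basis_neq0 hB (basis_one hB)) //].
by rewrite subr_eq0 => /eqP.
Qed.

End DualBasis.

Theorem corollary3p17 (R : realType)
    (zeta : seq bool -> R) (Hzeta : is_zeta_sh zeta)
    (J : seq bool -> R) (HJ : is_reg_int J)
    (B : set (UB5 R[i])) (hB : is_basis B) :
  PhiKZ_UB5 zeta 1 2 2 3 * PhiKZ_UB5 zeta 3 4 4 5 * PhiKZ_UB5 zeta 5 1 1 2
    * PhiKZ_UB5 zeta 2 3 3 4 * PhiKZ_UB5 zeta 4 5 5 1 = 1
  <-> (forall b : UB5 R[i], B b -> b <> 1 -> gamma_int J (dual_elt B b) = 0).
Proof.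
rewrite -(ncproj_gamma_int Hzeta HJ).
exact: (series_eq_one hB (gamma_int_series J hB) (gamma_int_dual_one hB HJ)).
Qed.
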